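(* Let $k$ be an algebraically closed field and let $A$ be a noetherian AS-Gorenstein Hopf $k$-algebra with bijective antipode $S$. Then there is an inner automorphism $\gamma$ of $A$ such that $$S^4=\gamma\circ\phi\circ\xi^{-1},$$ where $\phi$ and $\xi$ are respectively the right and left winding automorphisms of $A$ arising from the left integral of $A$.
   Context: Algebras are associative unital $k$-algebras; noetherian means left and right noetherian; $k$ also denotes the trivial module $A/\ker\epsilon$, $\epsilon$ the counit; $\Delta(a)=\sum a_1\otimes a_2$. AS-Gorenstein: a noetherian algebra $A$ with augmentation $\epsilon:A\to k$ is AS-Gorenstein (of injective dimension $d$) if (AS1) $\operatorname{injdim}({}_AA)=d<\infty$; (AS2) $\dim_k\operatorname{Ext}^d_A({}_Ak,{}_AA)=1$ and $\operatorname{Ext}^i_A({}_Ak,{}_AA)=0$ for all $i\ne d$; (AS3) the right-module versions of (AS1), (AS2) hold. The left integral is the one-dimensional right $A$-module $\int^l_A=\operatorname{Ext}^d_A({}_Ak,{}_AA)$, with right action induced by right multiplication on $A$. Let $\pi_0:A\to A/\mathrm{r.ann}(\int^l_A)=k$ be the algebra homomorphism through which $A$ acts on it. Then $\xi(a)=\sum\pi_0(a_1)a_2$ and $\phi(a)=\sum a_1\pi_0(a_2)$ for $a\in A$. *)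

(* Defs.v *)
From HB Require Import structures.
From mathcomp Require Import all_boot all_algebra.
From mathcomp Require Import sesquilinear.
From mathcomp Require Import boolp classical_sets functions.

Set Implicit Arguments.
Unset Strict Implicit.
Unset Printing Implicit Defensive.

Import GRing.Theory.
Local Open Scope ring_scope.
Local Open Scope quotient_scope.

(* Right modules over an algebra A are left modules over the opposite algebra,
   which is MathComp's converse ring A^c; it is made a k-algebra here. *)

Section ConverseAlgebra.
Variables (k : fieldType) (A : algType k).

HB.instance Definition _ := GRing.Lmodule.copy A^c A.

Fact converse_scalerAl (c : k) (x y : A^c) :
  c *: (x * y : A^c) = (c *: x : A^c) * y :> A^c.
Proof. exact: (@scalerAr k A c y x). Qed.

HB.instance Definition _ :=
  GRing.Lmodule_isLalgebra.Build k A^c converse_scalerAl.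

Fact converse_scalerAr (c : k) (x y : A^c) :
  c *: (x * y : A^c) = x * (c *: y : A^c) :> A^c.
Proof. exact: (@scalerAl k A c y x). Qed.

HB.instance Definition _ :=
  GRing.Lalgebra_isAlgebra.Build k A^c converse_scalerAr.

Variable chi : {lrmorphism A -> k^o}.

Definition converse_char (x : A^c) : k^o := chi x.

Fact converse_char_linear : linear converse_char.
Proof. exact: (linearP chi). Qed.

HB.instance Definition _ :=
  GRing.isLinear.Build k A^c k^o *:%R converse_char converse_char_linear.

Fact converse_char_monoid : monoid_morphism converse_char.
Proof.
split=> [|x y]; first exact: (rmorph1 chi).
by rewrite /converse_char [LHS](rmorphM chi) [LHS]mulrC.
Qed.

HB.instance Definition _ :=
  GRing.isMonoidMorphism.Build A^c k^o converse_char converse_char_monoid.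

Definition opposite_char : {lrmorphism A^c -> k^o} := converse_char.

End ConverseAlgebra.

Section CharacterModule.
Variables (k : fieldType) (A : algType k).

(* k with A acting through the character chi; for the counit of a Hopf algebra
   it is the trivial module. *)
Definition char_module (chi : {lrmorphism A -> k^o}) : Type := k.

Variable chi : {lrmorphism A -> k^o}.

HB.instance Definition _ := GRing.Zmodule.copy (char_module chi) k.

Definition char_scale (a : A) (x : char_module chi) : char_module chi :=
  (chi a : k) * (x : k).

Fact char_scaleA a b x : char_scale a (char_scale b x) = char_scale (a * b) x.
Proof. by rewrite /char_scale rmorphM mulrA. Qed.

Fact char_scale1 : left_id 1 char_scale.
Proof. by move=> x; rewrite /char_scale rmorph1 mul1r. Qed.

Fact char_scaleDr : right_distributive char_scale +%R.
Proof. by move=> a x y; apply: mulrDr. Qed.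

Fact char_scaleDl x : {morph char_scale^~ x : a b / a + b}.
Proof. by move=> a b; rewrite /char_scale rmorphD; apply: mulrDl. Qed.

HB.instance Definition _ := GRing.Zmodule_isLmodule.Build A (char_module chi)
  char_scaleA char_scale1 char_scaleDr char_scaleDl.

End CharacterModule.

Section QuotientModule.
Variables (R : pzRingType) (V : lmodType R) (U : {pred V}).

(* U, tagged with a proof that it is a submodule *)
Definition submod_tag (submodU : submod_closed U) : {pred V} := U.

Variable submodU : submod_closed U.

HB.instance Definition _ :=
  GRing.isSubmodClosed.Build R V (submod_tag submodU) submodU.

Definition quot_module : Type := Quotient.quot (submod_tag submodU).

HB.instance Definition _ := GRing.Zmodule.copy quot_module (Quotient.quot (submod_tag submodU)).

Definition quot_class (v : V) : quot_module := \pi_(Quotient.quot (submod_tag submodU)) v.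

Definition quot_scale (a : R) (q : quot_module) : quot_module :=
  quot_class (a *: repr (q : Quotient.quot (submod_tag submodU))).

Fact quot_classP v w : reflect (quot_class v = quot_class w) (v - w \in U).
Proof. by rewrite [_ \in U](Quotient.idealrBE (submod_tag submodU)); apply: eqP. Qed.

Fact quot_classD : {morph quot_class : v w / v + w}.
Proof. exact: raddfD. Qed.

Fact quot_class_surj q : exists v, q = quot_class v.
Proof. by exists (repr (q : Quotient.quot (submod_tag submodU))); rewrite /quot_class reprK. Qed.

Fact quot_scaleE a v : quot_scale a (quot_class v) = quot_class (a *: v).
Proof.
apply/quot_classP; rewrite -scalerBr; apply: (rpredZ (s := (submod_tag submodU))).
by apply/quot_classP; rewrite /quot_class reprK.
Qed.

Fact quot_scaleA a b q : quot_scale a (quot_scale b q) = quot_scale (a * b) q.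
Proof. by have [v ->] := quot_class_surj q; rewrite !quot_scaleE scalerA. Qed.

Fact quot_scale1 : left_id 1 quot_scale.
Proof.
by move=> q; have [v ->] := quot_class_surj q; rewrite quot_scaleE scale1r.
Qed.

Fact quot_scaleDr : right_distributive quot_scale +%R.
Proof.
move=> a p q; have [v ->] := quot_class_surj p.
have [w ->] := quot_class_surj q.
by rewrite -quot_classD !quot_scaleE scalerDr quot_classD.
Qed.

Fact quot_scaleDl q : {morph quot_scale^~ q : a b / a + b}.
Proof.
move=> a b; have [v ->] := quot_class_surj q.
by rewrite !quot_scaleE scalerDl quot_classD.
Qed.

HB.instance Definition _ := GRing.Zmodule_isLmodule.Build R quot_module
  quot_scaleA quot_scale1 quot_scaleDr quot_scaleDl.

End QuotientModule.

Section Homology.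
Variables (R : pzRingType) (X Y Z : lmodType R).
Variables (f : {linear X -> Y}) (g : {linear Y -> Z}).

Definition kernel_pred : {pred Y} := [pred y | g y == 0].

Fact kernel_pred_submod : submod_closed kernel_pred.
Proof.
split=> [|a u v]; rewrite !inE ?linear0 // => /eqP gu /eqP gv.
by rewrite linearP gu gv scaler0 addr0.
Qed.

HB.instance Definition _ :=
  GRing.isSubmodClosed.Build R Y kernel_pred kernel_pred_submod.

Record kernel : Type := Kernel { kernel_val :> Y; _ : kernel_val \in kernel_pred }.

HB.instance Definition _ := [isSub for kernel_val].
HB.instance Definition _ := [Choice of kernel by <:].
HB.instance Definition _ := [SubChoice_isSubLmodule of kernel by <:].

Definition image_pred : {pred kernel} :=
  [pred y | `[< exists x, kernel_val y = f x >]].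

Fact image_pred_submod : submod_closed image_pred.
Proof.
split=> [|a u v]; rewrite !inE.
  by exists 0; rewrite linear0.
move=> [x ux] [y vy]; exists (a *: x + y).
by rewrite linearP -ux -vy.
Qed.

(* ker g / (im f \cap ker g), that is ker g / im f in a complex *)
Definition homology : lmodType R := quot_module image_pred_submod.

End Homology.

Section Dual.
Variable R : nzRingType.

Section DualModule.
Variable V : lmodType R.

(* Hom_R(V, R) inside V -> R.  The scalar action on functions with values in
   the regular R^c-module is (r *: f) x = f x * r. *)
Definition dual_pred : {pred V -> R^c^o} :=
  [pred f | `[< linear (f : V -> R^o) >]].

Fact dual_pred_submod : submod_closed dual_pred.
Proof.
split=> [|r f g]; rewrite !inE.
  by move=> a x y; apply/esym; rewrite [LHS]addr0; apply: mulr0.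
move=> lf lg a x y.
have E u : (r *: f + g) u = (f u : R) * r + (g u : R) :> R by [].
rewrite !E [f (_ + _)]lf [g (_ + _)]lg.
change ((a * (f x : R) + f y) * r + (a * (g x : R) + g y) =
        a * ((f x : R) * r + g x) + ((f y : R) * r + g y)).
by rewrite mulrDl mulrDr mulrA addrACA.
Qed.

HB.instance Definition _ :=
  GRing.isSubmodClosed.Build R^c (V -> R^c^o) dual_pred dual_pred_submod.

Record dual : Type := Dual { dual_val :> V -> R^c^o; _ : dual_val \in dual_pred }.

HB.instance Definition _ := [isSub for dual_val].
HB.instance Definition _ := [Choice of dual by <:].
HB.instance Definition _ := [SubChoice_isSubLmodule of dual by <:].

End DualModule.

Variables (V W : lmodType R) (d : {linear V -> W}).

Fact dual_map_subproof (f : dual W) : (dual_val f) \o d \in @dual_pred V.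
Proof.
case: f => f f_dual; have := f_dual; rewrite !inE => lf a x y /=.
by rewrite linearP lf.
Qed.

Definition dual_map (f : dual W) : dual V := Dual (dual_map_subproof f).

Fact dual_map_linear : linear dual_map.
Proof. by move=> a f g; apply: val_inj. Qed.

HB.instance Definition _ :=
  GRing.isLinear.Build R^c (dual W) (dual V) *:%R dual_map dual_map_linear.

End Dual.

Section Resolutions.
Variable R : nzRingType.

Definition regular_module : lmodType R := R^o.

Definition projective (P : lmodType R) : Prop :=
  forall (M N : lmodType R) (g : {linear M -> N}) (f : {linear P -> N}),
    (forall y, exists x, g x = y) ->
    exists h : {linear P -> M}, forall x, g (h x) = f x.

Definition injective_module (I : lmodType R) : Prop :=
  forall (M N : lmodType R) (g : {linear M -> N}) (f : {linear M -> I}),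
    injective g ->
    exists h : {linear N -> I}, forall x, h (g x) = f x.

Record proj_resolution (M : lmodType R) := ProjResolution {
  pres_mod :> nat -> lmodType R;
  pres_d : forall i, {linear pres_mod i.+1 -> pres_mod i};
  pres_aug : {linear pres_mod 0%N -> M};
  pres_projective : forall i, projective (pres_mod i);
  pres_aug_surj : forall y, exists x, pres_aug x = y;
  pres_exact0 : forall x, pres_aug x = 0 <-> exists y, x = pres_d 0%N y;
  pres_exact : forall i x, pres_d i x = 0 <-> exists y, x = pres_d i.+1 y
}.

Record inj_resolution (M : lmodType R) := InjResolution {
  ires_mod :> nat -> lmodType R;
  ires_d : forall i, {linear ires_mod i -> ires_mod i.+1};
  ires_aug : {linear M -> ires_mod 0%N};
  ires_injective : forall i, injective_module (ires_mod i);
  ires_aug_inj : injective ires_aug;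
  ires_exact0 : forall x, ires_d 0%N x = 0 <-> exists y, x = ires_aug y;
  ires_exact : forall i x, ires_d i.+1 x = 0 <-> exists y, x = ires_d i y
}.

Definition injdim_le (M : lmodType R) (n : nat) : Prop :=
  exists I : inj_resolution M, forall i, (n < i)%N -> forall x : I i, x = 0.

Definition injdim_eq (M : lmodType R) (d : nat) : Prop :=
  injdim_le M d /\ forall n, injdim_le M n -> (d <= n)%N.

(* Ext^i_R(M, R), computed with the projective resolution P of M; it is an
   R^c-module through right multiplication on the values. *)
Definition Ext (M : lmodType R) (P : proj_resolution M) (i : nat)
    : lmodType R^c :=
  match i with
  | 0 => homology (\0 : {linear dual (P 0%N) -> dual (P 0%N)})
                  (dual_map (pres_d P 0))
  | j.+1 => homology (dual_map (pres_d P j)) (dual_map (pres_d P j.+1))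
  end.

(* ascending chain condition on left ideals, the submodules of R^o *)
Definition left_noetherian : Prop :=
  forall I : nat -> {pred R^o},
    (forall n, submod_closed (I n)) -> (forall n, {subset I n <= I n.+1}) ->
    exists n, forall m, (n <= m)%N -> I m =i I n.

End Resolutions.

Definition noetherian (R : nzRingType) : Prop :=
  left_noetherian R /\ left_noetherian R^c.

Section ASGorenstein.
Variables (k : fieldType).

Definition one_dimensional (A : algType k) (V : lmodType A) : Prop :=
  exists2 e : V, e <> 0 & forall v, exists c : k, v = c%:A *: e.

Definition zero_module (R : nzRingType) (V : lmodType R) : Prop :=
  forall v : V, v = 0.

Variables (A : algType k) (eps : {lrmorphism A -> k^o}).

Definition left_trivial : lmodType A := char_module eps.
Definition right_trivial : lmodType A^c := char_module (opposite_char eps).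

(* P and Q are projective resolutions of the left and the right trivial
   module; the Ext groups do not depend on them. *)
Record AS_Gorenstein (P : proj_resolution left_trivial)
    (Q : proj_resolution right_trivial) (d : nat) : Prop := {
  AS_noetherian : noetherian A;
  AS1_left : injdim_eq (regular_module A) d;
  AS2_left : one_dimensional (Ext P d : lmodType A^c);
  AS2_left0 : forall i, i <> d -> zero_module (Ext P i);
  AS1_right : injdim_eq (regular_module A^c) d;
  AS2_right : one_dimensional (Ext Q d : lmodType A^c^c);
  AS2_right0 : forall i, i <> d -> zero_module (Ext Q i)
}.

(* chi is the character through which A acts on the right on Ext^d_A(k, A). *)
Definition left_integral_char (P : proj_resolution left_trivial) (d : nat)
    (chi : {lrmorphism A -> k^o}) : Prop :=
  forall (a : A) (e : Ext P d), (a : A^c) *: e = ((chi a : k)%:A : A^c) *: e.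

End ASGorenstein.

Section Tensors.
Variables (k : fieldType) (A : algType k).

(* A list of pairs [:: (a1, b1); ...] stands for the tensor
   a1 (x) b1 + ... of A (x) A.  Two lists are the same tensor iff they have the
   same image under every bilinear map (universal property of A (x) A).
   Likewise for triples and A (x) A (x) A. *)
Definition tensor2_eq (s t : seq (A * A)) : Prop :=
  forall (V : lmodType k) (f : A -> A -> V), bilinear_for *:%R *:%R f ->
    \sum_(p <- s) f p.1 p.2 = \sum_(p <- t) f p.1 p.2.

Definition trilinear (V : lmodType k) (f : A -> A -> A -> V) : Prop :=
  [/\ forall y z, linear (fun x => f x y z),
      forall x z, linear (fun y => f x y z)
    & forall x y, linear (f x y)].

Definition tensor3_eq (s t : seq (A * A * A)) : Prop :=
  forall (V : lmodType k) (f : A -> A -> A -> V), trilinear f ->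
    \sum_(p <- s) f p.1.1 p.1.2 p.2 = \sum_(p <- t) f p.1.1 p.1.2 p.2.

End Tensors.

(* comul a is a list of pairs (a_1, a_2) with Delta(a) = sum a_1 (x) a_2. *)
Record hopf_algebra (k : fieldType) (A : algType k) := HopfAlgebra {
  comul : A -> seq (A * A);
  counit : {lrmorphism A -> k^o};
  antipode : {linear A -> A};
  comul_linear : forall (c : k) a b,
    tensor2_eq (comul (c *: a + b))
               ([seq (c *: p.1, p.2) | p <- comul a] ++ comul b);
  comul1 : tensor2_eq (comul 1) [:: (1, 1)];
  comulM : forall a b,
    tensor2_eq (comul (a * b))
               [seq (p.1 * q.1, p.2 * q.2) | p <- comul a, q <- comul b];
  comulA : forall a,
    tensor3_eq [seq (q.1, q.2, p.2) | p <- comul a, q <- comul p.1]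
               [seq (p.1, q.1, q.2) | p <- comul a, q <- comul p.2];
  counitl : forall a, \sum_(p <- comul a) (counit p.1 : k) *: p.2 = a;
  counitr : forall a, \sum_(p <- comul a) (counit p.2 : k) *: p.1 = a;
  antipodel : forall a,
    \sum_(p <- comul a) antipode p.1 * p.2 = (counit a : k)%:A;
  antipoder : forall a,
    \sum_(p <- comul a) p.1 * antipode p.2 = (counit a : k)%:A
}.

Section Winding.
Variables (k : fieldType) (A : algType k) (H : hopf_algebra A).
Variable chi : {lrmorphism A -> k^o}.

Definition left_winding (a : A) : A :=
  \sum_(p <- comul H a) (chi p.1 : k) *: p.2.

Definition right_winding (a : A) : A :=
  \sum_(p <- comul H a) (chi p.2 : k) *: p.1.

End Winding.

Definition inner_automorphism (R : nzRingType) (gamma : R -> R) : Prop :=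
  exists u v : R, [/\ u * v = 1, v * u = 1 & forall a, gamma a = u * a * v].

(* Main.v *)
(* Let R = A (x) A^op.  The map rho : A -> R, a |-> a_1 (x) S(a_2), is a ring
   homomorphism, and R is free over rho(A) on both sides with basis 1 (x) A.  Hence
   rho carries a resolution of the trivial module k by finitely generated free
   modules (A is noetherian) to a free resolution of the R-module A, and the top
   cohomology of the R-dual of the latter is Ext^d_A(k, A) (x) A: every class is
   uniquely [rho(z)(1 (x) b)], where z represents the left integral.  From
   x (x) 1 = sum rho(x_1)(1 (x) S^2(x_2)) one gets
   [rho(z)](x (x) 1) = [rho(z)(1 (x) S^2(xi x))].
   The co-opposite Hopf algebra, with antipode S^-1, yields in the same way a second
   resolution of the R-module A, with the twist S^-2 phi in place of S^2 xi.
   Comparing the two resolutions gives a unit u of A with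
   S^-2(phi x) u = u S^2(xi x), which is the assertion after applying S^2. *)

From HB Require Import structures.
Require Import Defs.
From mathcomp Require Import all_boot all_algebra.
From mathcomp Require Import sesquilinear.
From mathcomp Require Import boolp classical_sets.

Set Implicit Arguments.
Unset Strict Implicit.
Unset Printing Implicit Defensive.

Import GRing.Theory.
Local Open Scope ring_scope.
Local Open Scope quotient_scope.

(** * Splittings of linear maps over a field *)

(** It is stated as a universal property: [R] is [A (x) A] by way of [sigma b * rho a], and also by
    way of [rho a * sigma b]. Hence every [k]-linear map between matrices over [A], not only an
    [A]-linear one, extends to matrices over [R]. Over a field, exactness is witnessed by an
    identity [id = f h + g' g] of [k]-linear maps, and such an identity extends verbatim. Both
    orders of the factors are required because the resolution consists of rows, on which [rho(D)]
    acts from the right, and its dual of columns, on which it acts from the left. Only the second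
    order produces [S^2]: there [S(x_2)] has to be cancelled from the other side, by
    [S^2(x_3) S(x_2) = S(x_2 S(x_3))]. The two Hopf structures share multiplication and counit,
    hence the resolution of [k], the column [z] and the character; they differ only in [rho] and in
    the side of the winding. Ext is given by an arbitrary projective resolution, so its generator
    must be carried over to a finite free one before it becomes a column of a matrix complex. *)

Lemma linear_of_fun (R : pzRingType) (V W : lmodType R) (f : V -> W) :
  linear f -> exists g : {linear V -> W}, g =1 f.
Proof.
move=> lf; pose fM := GRing.isLinear.Build R V W *:%R f lf.
pose g : {linear V -> W} := HB.pack f fM.
by exists g.
Qed.

Lemma linear_choice (R : pzRingType) (V W : lmodType R) (r : V -> W -> Prop) :
  (forall v, exists w, r v w) ->
  (forall v w w', r v w -> r v w' -> w = w') ->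
  (forall a v v' w w', r v w -> r v' w' -> r (a *: v + v') (a *: w + w')) ->
  exists g : {linear V -> W}, forall v, r v (g v).
Proof.
move=> /choice [f fP] r_uniq r_lin.
have [|g gE] := @linear_of_fun _ _ _ f; last by exists g => v; rewrite gE.
by move=> a v v'; apply: r_uniq (fP _) (r_lin _ _ _ _ _ (fP v) (fP v')).
Qed.

Section Splitting.
Variable k : fieldType.

(** Zorn's lemma gives a maximal subset that is closed and meets [U] at most in 0; it is a
    complement of [U], and [p] is the projection along it. *)
Lemma submodule_projection (V : lmodType k) (U : set V) :
  U 0 -> (forall a u v, U u -> U v -> U (a *: u + v)) ->
  exists p : {linear V -> V}, (forall v, U (p v)) /\ (forall u, U u -> p u = u).
Proof.
move=> U0 Ulin.
pose disjoint_closed (C : set V) :=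
  (forall a u v, C u -> C v -> C (a *: u + v)) /\ (forall u, C u -> U u -> u = 0).
have [F FP F_total|C [[Clin CU] Cmax]] := @Zorn_bigcup V disjoint_closed.
  split=> [a u v [X FX Xu] [Y FY Yv]|u [X FX Xu]]; last by case: (FP _ FX) => _; apply.
  have [XY|YX] := F_total _ _ FX FY.
    by exists Y => //; apply: (FP _ FY).1 => //; apply: XY.
  by exists X => //; apply: (FP _ FX).1 => //; apply: YX.
(* The empty set satisfies [disjoint_closed], as the union of the empty chain must, so 0 is adjoined
   by hand. *)
pose C0 : set V := (fun c => C c \/ c = 0).
have C0lin a u v : C0 u -> C0 v -> C0 (a *: u + v).
  move=> [Cu|->] [Cv|->]; rewrite ?scaler0 ?add0r ?addr0; try by [left|right|left; apply: Clin].
  (* Since [C] may lack 0, scaling is obtained from closure under [a u + v] with [v = u]. *)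
  left; have -> : a *: u = (a - 1) *: u + u by rewrite scalerBl scale1r subrK.
  exact: Clin.
have C0U u : C0 u -> U u -> u = 0 by case=> [/CU|->].
have Udiff u v : U u -> U v -> U (u - v).
  by move=> Uu Uv; rewrite addrC -scaleN1r; apply: Ulin.
have C0diff u v : C0 u -> C0 v -> C0 (u - v).
  by move=> Cu Cv; rewrite addrC -scaleN1r; apply: C0lin.
have Uscale a u : U u -> U (a *: u) by move=> Uu; rewrite -[_ *: _]addr0; apply: Ulin.
have C0scale a u : C0 u -> C0 (a *: u).
  by move=> Cu; rewrite -[_ *: _]addr0; apply: C0lin => //; right.
have decomp v : exists u, U u /\ C0 (v - u).
  (* A vector [v] outside [U + C0] would make [k v + C0] a strictly larger candidate. *)
  apply: contrapT => v_out.
  pose B : set V := (fun x => exists a c, C0 c /\ x = a *: v + c).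
  apply: (Cmax B); first split.
  - by move=> c Cc; exists 0, c; rewrite scale0r add0r; split => //; left.
  - by move=> CB; apply: v_out; exists 0; split=> //; left; rewrite subr0; apply: CB;
       exists 1, 0; rewrite scale1r addr0; split => //; right.
  split=> [a x y [b [c [Cc ->]]] [b' [c' [Cc' ->]]]|x [a [c [Cc ->]]] Ux].
    exists (a * b + b'), (a *: c + c'); split; first exact: C0lin.
    by rewrite scalerDr scalerA scalerDl addrACA.
  have [a0|a_neq0] := eqVneq a 0.
    by move: Ux; rewrite a0 scale0r add0r; apply: C0U.
  case: v_out; exists (a^-1 *: (a *: v + c)); split; first exact: Uscale.
  rewrite scalerDr scalerA mulVf // scale1r opprD addrA subrr add0r -scaleN1r.
  exact/C0scale/C0scale.
have [||p pP] := @linear_choice _ _ _ (fun v u => U u /\ C0 (v - u)) decomp.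
- move=> v u u' [Uu Cu] [Uu' Cu']; apply/eqP; rewrite -subr_eq0; apply/eqP.
  apply: C0U; last exact: Udiff.
  have -> : u - u' = (v - u') - (v - u) by rewrite opprB [RHS]addrC subrKA.
  exact: C0diff.
- move=> a v v' u u' [Uu Cu] [Uu' Cu']; split; first exact: Ulin.
  by rewrite opprD addrACA -scalerBr; apply: C0lin.
exists p; split=> [v|u Uu]; first by case: (pP v).
have [Upu Cpu] := pP u.
by apply/esym/eqP; rewrite -subr_eq0; apply/eqP/C0U => //; apply: Udiff.
Qed.

(** The map [g] first projects onto the image of [f] and then takes the preimage lying in a fixed
    complement of the kernel. It supplies the [k]-linear homotopies that carry exactness over to the
    enveloping algebra. *)
Lemma linear_pseudo_inverse (V W : lmodType k) (f : {linear V -> W}) :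
  exists g : {linear W -> V}, forall v, f (g (f v)) = f v.
Proof.
have [||p [p_im p_id]] := @submodule_projection W (fun w => exists v, f v = w).
- by exists 0; rewrite linear0.
- by move=> a _ _ [u <-] [v <-]; exists (a *: u + v); rewrite linearP.
(* With [q] a projection onto the kernel of [f], the condition [q v = 0] singles out one preimage,
   so that [linear_choice] applies. *)
have [||q [q_ker q_id]] := @submodule_projection V (fun v => f v = 0).
- by rewrite /= linear0.
- by move=> a u v /= fu fv; rewrite linearP fu fv scaler0 addr0.
have [|||g gP] := @linear_choice _ W V (fun w v => f v = p w /\ q v = 0).
- move=> w; have [v fv] := p_im w; exists (v - q v).
  by rewrite !linearB /= q_ker subr0 [q (q v)]q_id ?subrr.
- move=> w v v' [fv qv] [fv' qv']; apply/eqP; rewrite -subr_eq0 -[_ - _]q_id /=.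
    by rewrite linearB qv qv' subr0.
  by rewrite linearB /= fv fv' subrr.
- by move=> a w w' v v' [fv qv] [fv' qv']; rewrite !linearP fv fv' qv qv' scaler0 addr0.
by exists g => v; rewrite (gP _).1 p_id //; exists v.
Qed.

End Splitting.

(** * The enveloping algebra *)

Section Enveloping.
Variables (k : fieldType) (A : algType k).
Implicit Types (c : k) (s t : seq (A * A)).

(** Equality of tensors quantifies over all vector spaces; its classical truth value turns it into a
    boolean relation, as the quotient construction demands. *)
Definition tensor2_eqb s t : bool := `[< tensor2_eq s t >].

Fact tensor2_eqb_refl : reflexive tensor2_eqb.
Proof. by move=> s; apply/asboolP. Qed.

Fact tensor2_eqb_sym : symmetric tensor2_eqb.
Proof. by move=> s t; apply/asboolP/asboolP => E V f /E. Qed.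

Fact tensor2_eqb_trans : transitive tensor2_eqb.
Proof.
move=> t s u /asboolP E1 /asboolP E2; apply/asboolP => V f bf.
exact: etrans (E1 V f bf) (E2 V f bf).
Qed.

Canonical tensor2_equiv :=
  EquivRel tensor2_eqb tensor2_eqb_refl tensor2_eqb_sym tensor2_eqb_trans.

(* A (x) A^op: the product, defined below, is reversed in the second factor. *)
Definition enveloping : Type := {eq_quot tensor2_equiv}.
HB.instance Definition _ := Choice.on enveloping.

Definition tensors s : enveloping := \pi_({eq_quot tensor2_equiv}) s.

Lemma tensorsP s t : tensors s = tensors t <-> tensor2_eq s t.
Proof.
split=> [/eqmodP/asboolP //|st].
by apply/eqmodP/asboolP.
Qed.

Lemma tensors_surj (x : enveloping) : exists s, x = tensors s.
Proof. by exists (repr (x : {eq_quot tensor2_equiv})); rewrite /tensors reprK. Qed.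

Lemma tensor2_eq_repr s : tensor2_eq (repr (tensors s : {eq_quot tensor2_equiv})) s.
Proof. by apply/tensorsP; rewrite /tensors reprK. Qed.

Definition enveloping_rep (x : enveloping) : seq (A * A) :=
  repr (x : {eq_quot tensor2_equiv}).

Definition enveloping_add (x y : enveloping) : enveloping :=
  tensors (enveloping_rep x ++ enveloping_rep y).

Definition enveloping_scale c (x : enveloping) : enveloping :=
  tensors [seq (c *: p.1, p.2) | p <- enveloping_rep x].

Definition enveloping_mul (x y : enveloping) : enveloping :=
  tensors [seq (p.1 * q.1, q.2 * p.2) | p <- enveloping_rep x, q <- enveloping_rep y].

Lemma enveloping_addE s t : enveloping_add (tensors s) (tensors t) = tensors (s ++ t).
Proof.
apply/tensorsP => V f bf; rewrite !big_cat /=.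
by rewrite !(tensor2_eq_repr _ bf).
Qed.

Lemma bilinear_scale (V : lmodType k) (f : A -> A -> V) c :
  bilinear_for *:%R *:%R f -> forall x y, f (c *: x) y = c *: f x y.
Proof.
move=> [fl _] x y; have [g gE] := linear_of_fun (fl y).
by rewrite -!gE linearZ.
Qed.

Lemma enveloping_scaleE c s :
  enveloping_scale c (tensors s) = tensors [seq (c *: p.1, p.2) | p <- s].
Proof.
apply/tensorsP => V f bf; rewrite !big_map /=.
under eq_bigr do rewrite (bilinear_scale _ bf).
under [RHS]eq_bigr do rewrite (bilinear_scale _ bf).
by rewrite -!scaler_sumr (tensor2_eq_repr _ bf).
Qed.

Lemma enveloping_mulE s t : enveloping_mul (tensors s) (tensors t) =
  tensors [seq (p.1 * q.1, q.2 * p.2) | p <- s, q <- t].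
Proof.
apply/tensorsP => V f [fl fr]; rewrite !big_allpairs_dep /=.
(* With the right-hand list fixed, the sum over it is bilinear in the entries of the left-hand one,
   so the representative of [s] can be exchanged as a whole; the representative of [t] is then
   exchanged term by term. *)
have -> := tensor2_eq_repr s (f := fun x y =>
  \sum_(q <- enveloping_rep (tensors t)) f (x * q.1) (q.2 * y)).
  apply: eq_bigr => p _.
  apply: (tensor2_eq_repr t (f := fun x y => f (p.1 * x) (y * p.2))).
  split=> [y c x x'|x c y y'] /=.
    by rewrite mulrDr -scalerAr fl.
  by rewrite mulrDl -scalerAl fr.
split=> [y c x x'|x c y y'] /=.
  rewrite scaler_sumr -big_split /=; apply: eq_bigr => q _.
  by rewrite mulrDl -scalerAl fl.
rewrite scaler_sumr -big_split /=; apply: eq_bigr => q _.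
by rewrite mulrDr -scalerAr fr.
Qed.

Fact enveloping_addA : associative enveloping_add.
Proof.
move=> x y z; have [[s ->] [t ->] [u ->]] := And3 (tensors_surj x) (tensors_surj y) (tensors_surj z).
by rewrite !enveloping_addE catA.
Qed.

Fact enveloping_addC : commutative enveloping_add.
Proof.
move=> x y; have [[s ->] [t ->]] := (tensors_surj x, tensors_surj y).
by rewrite !enveloping_addE; apply/tensorsP => V f _; rewrite !big_cat /= addrC.
Qed.

Fact enveloping_add0 : left_id (tensors [::]) enveloping_add.
Proof. by move=> x; have [s ->] := tensors_surj x; rewrite enveloping_addE. Qed.

Fact enveloping_addN : left_inverse (tensors [::]) (enveloping_scale (-1)) enveloping_add.
Proof.
move=> x; have [s ->] := tensors_surj x; rewrite enveloping_scaleE enveloping_addE.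
apply/tensorsP => V f bf; rewrite big_cat big_nil big_map /=.
under eq_bigr do rewrite (bilinear_scale _ bf) scaleN1r.
by rewrite sumrN addNr.
Qed.

HB.instance Definition _ := GRing.isZmodule.Build enveloping
  enveloping_addA enveloping_addC enveloping_add0 enveloping_addN.

Lemma tensors_cat s t : tensors (s ++ t) = tensors s + tensors t.
Proof. by rewrite -enveloping_addE. Qed.

Fact enveloping_scaleA b c x :
  enveloping_scale b (enveloping_scale c x) = enveloping_scale (b * c) x.
Proof.
have [s ->] := tensors_surj x; rewrite !enveloping_scaleE -map_comp; congr tensors.
by apply: eq_map => p /=; rewrite scalerA.
Qed.

Fact enveloping_scale1 : left_id 1 enveloping_scale.
Proof.
move=> x; have [s ->] := tensors_surj x; rewrite !enveloping_scaleE; congr tensors.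
by rewrite -[RHS]map_id; apply: eq_map => -[a b] /=; rewrite scale1r.
Qed.

Fact enveloping_scaleDr : right_distributive enveloping_scale +%R.
Proof.
move=> c x y; have [[s ->] [t ->]] := (tensors_surj x, tensors_surj y).
by rewrite -tensors_cat !enveloping_scaleE map_cat tensors_cat.
Qed.

Fact enveloping_scaleDl x : {morph enveloping_scale^~ x : b c / b + c}.
Proof.
move=> b c; have [s ->] := tensors_surj x; rewrite !enveloping_scaleE -tensors_cat.
apply/tensorsP => V f bf; rewrite big_cat /= !big_map -big_split /=.
by apply: eq_bigr => p _; rewrite !(bilinear_scale _ bf) scalerDl.
Qed.

HB.instance Definition _ := GRing.Zmodule_isLmodule.Build k enveloping
  enveloping_scaleA enveloping_scale1 enveloping_scaleDr enveloping_scaleDl.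

Definition tensor (a b : A) : enveloping := tensors [:: (a, b)].

Lemma tensorsE s : tensors s = \sum_(p <- s) tensor p.1 p.2.
Proof.
elim: s => [|[a b] s IHs]; first by rewrite big_nil.
by rewrite big_cons -IHs -tensors_cat.
Qed.

Lemma tensor_sum (x : enveloping) : exists s, x = \sum_(p <- s) tensor p.1 p.2.
Proof. by have [s ->] := tensors_surj x; exists s; apply: tensorsE. Qed.

Lemma tensor_bilinear : bilinear_for *:%R *:%R tensor.
Proof.
have scaleE c s : c *: tensors s = tensors [seq (c *: p.1, p.2) | p <- s].
  exact: enveloping_scaleE.
split=> [y c x x'|x c y y'] /=; rewrite /tensor scaleE -tensors_cat.
  by apply/tensorsP => V f bf; rewrite /= !big_cons !big_nil /= !addr0 bf.1 (bilinear_scale _ bf).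
apply/tensorsP => V f bf; rewrite /= !big_cons !big_nil /= !addr0.
by rewrite (bilinear_scale _ bf) bf.2.
Qed.

Lemma tensor_lift (V : lmodType k) (f : A -> A -> V) :
  bilinear_for *:%R *:%R f ->
  exists g : {linear enveloping -> V}, forall a b, g (tensor a b) = f a b.
Proof.
move=> bf; pose g (x : enveloping) := \sum_(p <- enveloping_rep x) f p.1 p.2.
have gE s : g (tensors s) = \sum_(p <- s) f p.1 p.2 by apply: tensor2_eq_repr.
have [|h hE] := @linear_of_fun _ _ _ g.
  move=> c x y; have [[s ->] [t ->]] := (tensors_surj x, tensors_surj y).
  rewrite [c *: _]enveloping_scaleE -tensors_cat !gE big_cat big_map /=.
  under eq_bigr do rewrite (bilinear_scale _ bf).
  by rewrite -scaler_sumr.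
by exists h => a b; rewrite hE gE big_seq1.
Qed.

Fact enveloping_mulA : associative enveloping_mul.
Proof.
move=> x y z; have [[s ->] [t ->] [u ->]] := And3 (tensors_surj x) (tensors_surj y) (tensors_surj z).
rewrite !enveloping_mulE; apply/tensorsP => V f _.
rewrite !big_allpairs_dep /=; apply: eq_bigr => p _.
rewrite big_allpairs_dep; apply: eq_bigr => q _; apply: eq_bigr => r _ /=.
by rewrite !mulrA.
Qed.

Fact enveloping_mul1l : left_id (tensor 1 1) enveloping_mul.
Proof.
move=> x; have [s ->] := tensors_surj x; rewrite enveloping_mulE.
apply/tensorsP => V f _; rewrite big_allpairs_dep big_seq1 /=.
by apply: eq_bigr => p _; rewrite mul1r mulr1.
Qed.

Fact enveloping_mul1r : right_id (tensor 1 1) enveloping_mul.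
Proof.
move=> x; have [s ->] := tensors_surj x; rewrite enveloping_mulE.
apply/tensorsP => V f _; rewrite big_allpairs_dep.
by apply: eq_bigr => p _; rewrite big_seq1 mul1r mulr1.
Qed.

Fact enveloping_mulDl : left_distributive enveloping_mul +%R.
Proof.
move=> x y z; have [[s ->] [t ->] [u ->]] := And3 (tensors_surj x) (tensors_surj y) (tensors_surj z).
rewrite -tensors_cat !enveloping_mulE -tensors_cat.
by apply/tensorsP => V f _; rewrite big_cat !big_allpairs_dep big_cat.
Qed.

Fact enveloping_mulDr : right_distributive enveloping_mul +%R.
Proof.
move=> x y z; have [[s ->] [t ->] [u ->]] := And3 (tensors_surj x) (tensors_surj y) (tensors_surj z).
rewrite -tensors_cat !enveloping_mulE -tensors_cat.
apply/tensorsP => V f _; rewrite big_cat /= !big_allpairs_dep -big_split.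
by apply: eq_bigr => p _; rewrite big_cat.
Qed.

Fact enveloping_1_neq0 : tensor 1 1 != 0.
Proof.
have [|g gE] := @tensor_lift A *%R.
  split=> [y c x x'|x c y y'] /=; first by rewrite mulrDl -scalerAl.
  by rewrite mulrDr -scalerAr.
apply/eqP => /(congr1 g); rewrite gE linear0 mulr1 => /eqP.
by rewrite oner_eq0.
Qed.

HB.instance Definition _ := GRing.Zmodule_isNzRing.Build enveloping
  enveloping_mulA enveloping_mul1l enveloping_mul1r
  enveloping_mulDl enveloping_mulDr enveloping_1_neq0.

Lemma tensorM a b a' b' : tensor a b * tensor a' b' = tensor (a * a') (b' * b).
Proof. exact: enveloping_mulE. Qed.

Fact enveloping_scaleAl c (x y : enveloping) : c *: (x * y) = (c *: x) * y.
Proof.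
have [[s ->] [t ->]] := (tensors_surj x, tensors_surj y).
rewrite [LHS](congr1 (enveloping_scale c) (enveloping_mulE _ _)) enveloping_scaleE.
rewrite [c *: _]enveloping_scaleE [RHS]enveloping_mulE.
apply/tensorsP => V f _; rewrite big_map !big_allpairs_dep big_map /=.
by apply: eq_bigr => p _; apply: eq_bigr => q _ /=; rewrite scalerAl.
Qed.

HB.instance Definition _ :=
  GRing.Lmodule_isLalgebra.Build k enveloping enveloping_scaleAl.

Fact enveloping_scaleAr c (x y : enveloping) : c *: (x * y) = x * (c *: y).
Proof.
have [[s ->] [t ->]] := (tensors_surj x, tensors_surj y).
rewrite [LHS](congr1 (enveloping_scale c) (enveloping_mulE _ _)) enveloping_scaleE.
rewrite [c *: _]enveloping_scaleE [RHS]enveloping_mulE.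
apply/tensorsP => V f _; rewrite big_map !big_allpairs_dep /=.
by apply: eq_bigr => p _; rewrite big_map; apply: eq_bigr => q _ /=; rewrite scalerAr.
Qed.

HB.instance Definition _ :=
  GRing.Lalgebra_isAlgebra.Build k enveloping enveloping_scaleAr.

End Enveloping.

(** * Hopf algebras *)

Lemma linear_bigsum (R : pzRingType) (V W : lmodType R) (I : Type) (r : seq I)
  (f : I -> V -> W) : (forall i, linear (f i)) -> linear (fun x => \sum_(i <- r) f i x).
Proof.
move=> lf c x y; rewrite scaler_sumr -big_split /=.
by apply: eq_bigr => i _; rewrite lf.
Qed.

Lemma bigsum_linear (R : pzRingType) (V W : lmodType R) (I : Type) (r : seq I)
  (F : I -> V) (f : V -> W) : linear f -> f (\sum_(i <- r) F i) = \sum_(i <- r) f (F i).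
Proof.
move=> /linear_of_fun [g gE]; rewrite -gE linear_sum.
by apply: eq_bigr => i _; rewrite gE.
Qed.

(** This says that [tau] exhibits [T] as [A (x) A]. The middle clause gives uniqueness of maps out
    of [T], the last one existence; together they replace the choice of a basis. *)
Definition tensor_product_map (k : fieldType) (A T : lmodType k) (tau : A -> A -> T) :=
  [/\ bilinear_for *:%R *:%R tau,
      forall t, exists s : seq (A * A), t = \sum_(p <- s) tau p.1 p.2
    & forall (V : lmodType k) (f : A -> A -> V), bilinear_for *:%R *:%R f ->
        exists g : {linear T -> V}, forall a b, g (tau a b) = f a b].

Section HopfTheory.
Variables (k : fieldType) (A : algType k) (H : hopf_algebra A).
Local Notation S := (antipode H).
Local Notation eps a := (counit H a : k).

Let SD x y : S (x + y) = S x + S y. Proof. exact: linearD. Qed.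
Let SZ (c : k) x : S (c *: x) = c *: S x. Proof. exact: linearZ. Qed.
Let epsD x y : eps (x + y) = eps x + eps y. Proof. exact: linearD. Qed.
Let epsZ (c : k) x : eps (c *: x) = c * eps x. Proof. by rewrite linearZ. Qed.
Let tensorDl x x' y : tensor (x + x') y = tensor x y + tensor x' y :> enveloping A.
Proof. by have := (tensor_bilinear A).1 y 1 x x'; rewrite /= !scale1r. Qed.
Let tensorDr x y y' : tensor x (y + y') = tensor x y + tensor x y' :> enveloping A.
Proof. by have := (tensor_bilinear A).2 x 1 y y'; rewrite /= !scale1r. Qed.
Let tensorZl (c : k) x y : tensor (c *: x) y = c *: tensor x y :> enveloping A.
Proof. exact: bilinear_scale (tensor_bilinear A) _ _. Qed.
Let tensorZr (c : k) x y : tensor x (c *: y) = c *: tensor x y :> enveloping A.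
Proof. by have [g gE] := linear_of_fun ((tensor_bilinear A).2 x); rewrite -!gE linearZ. Qed.
Let linE := (mulrDl, mulrDr, SD, SZ, epsD, epsZ, tensorDl, tensorDr, tensorZl, tensorZr,
  fun c (x y : A) => esym (scalerAl c x y), fun c (x y : A) => esym (scalerAr c x y)).

Lemma sweedler_linear (V : lmodType k) (f : A -> A -> V) :
  bilinear_for *:%R *:%R f -> linear (fun a => \sum_(p <- comul H a) f p.1 p.2).
Proof.
move=> bf c a b; rewrite (comul_linear H c a b bf) big_cat big_map /= scaler_sumr.
by congr (_ + _); apply: eq_bigr => p _; apply: bilinear_scale.
Qed.

Lemma sweedler_coassoc (V : lmodType k) (f : A -> A -> A -> V) a : trilinear f ->
  \sum_(p <- comul H a) \sum_(q <- comul H p.1) f q.1 q.2 p.2 =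
  \sum_(p <- comul H a) \sum_(q <- comul H p.2) f p.1 q.1 q.2.
Proof. by move=> /(comulA H a); rewrite !big_allpairs_dep. Qed.

Lemma sweedler_counitl (V : lmodType k) (f : A -> V) a :
  linear f -> \sum_(p <- comul H a) eps p.1 *: f p.2 = f a.
Proof.
move=> /linear_of_fun [g gE]; rewrite -gE -[in RHS](counitl H a) linear_sum.
by apply: eq_bigr => p _; rewrite linearZ -gE.
Qed.

Lemma sweedler_counitr (V : lmodType k) (f : A -> V) a :
  linear f -> \sum_(p <- comul H a) eps p.2 *: f p.1 = f a.
Proof.
move=> /linear_of_fun [g gE]; rewrite -gE -[in RHS](counitr H a) linear_sum.
by apply: eq_bigr => p _; rewrite linearZ -gE.
Qed.

Lemma antipode1 : S 1 = 1.
Proof.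
have bf : bilinear_for *:%R *:%R (fun x y => S x * y).
  by split=> [y c x x'|x c y y'] /=; rewrite !linE.
have := comul1 H bf; rewrite antipodel big_seq1 mulr1 => <-.
by rewrite (rmorph1 (counit H)) scale1r.
Qed.

(** The sum [S(a_1 b_1) a_2 b_2 S(b_3) S(a_3)] is evaluated twice. Collapsing the left part leaves
    [S(b) S(a)]; reassociating and collapsing [a_2 b_2 S(b_3) S(a_3)] leaves [S(a b)]. *)
Lemma antipodeM a b : S (a * b) = S b * S a.
Proof.
have SM u v : \sum_(p <- comul H u) \sum_(q <- comul H v)
    S (p.1 * q.1) * (p.2 * q.2) = (eps u * eps v)%:A.
  have bf : bilinear_for *:%R *:%R (fun x y => S x * y).
    by split=> [y c x x'|x c y y'] /=; rewrite !linE.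
  by have := comulM H u v bf; rewrite antipodel big_allpairs_dep (rmorphM (counit H)).
transitivity (\sum_(p <- comul H a) \sum_(q <- comul H b)
    (\sum_(p' <- comul H p.1) \sum_(q' <- comul H q.1)
      S (p'.1 * q'.1) * (p'.2 * q'.2)) * (S q.2 * S p.2)); last first.
  under eq_bigr => p _ do under eq_bigr => q _ do
    rewrite SM -scalerAl mul1r -scalerA.
  under eq_bigr => p _ do rewrite -scaler_sumr.
  rewrite (@sweedler_counitl _ (fun x => \sum_(q <- comul H b) _ *: (S q.2 * S x))).
    by rewrite (@sweedler_counitl _ (fun x => S x * S a)) // => c x y; rewrite !linE.
  by apply: linear_bigsum => q c x y; rewrite !linE scalerDr !scalerA mulrC.
pose f (q q' : A * A) x y z := S (x * q'.1) * (y * q'.2) * (S q.2 * S z).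
pose F x y z := \sum_(q <- comul H b) \sum_(q' <- comul H q.1) f q q' x y z.
have F3 : trilinear F.
  by split=> [y z|x z|x y]; do 2!apply: linear_bigsum => ?; move=> c u v;
    rewrite /f !linE.
transitivity (\sum_(p <- comul H a) \sum_(p' <- comul H p.1) F p'.1 p'.2 p.2); last first.
  apply: eq_bigr => p _; rewrite exchange_big; apply: eq_bigr => q _ /=.
  by rewrite mulr_suml; apply: eq_bigr => p' _; rewrite mulr_suml.
rewrite (sweedler_coassoc a F3).
pose G (p p' : A * A) x y z := S (p.1 * x) * (p'.1 * y) * (S z * S p'.2).
transitivity (\sum_(p <- comul H a) \sum_(p' <- comul H p.2)
    \sum_(q <- comul H b) \sum_(q' <- comul H q.2) G p p' q.1 q'.1 q'.2); last first.
  apply: eq_bigr => p _; apply: eq_bigr => p' _; rewrite -(sweedler_coassoc b) //.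
  by split=> [y z|x z|x y] c u v; rewrite /G !linE.
transitivity (\sum_(p <- comul H a) \sum_(q <- comul H b) (eps q.2 * eps p.2) *: S (p.1 * q.1)).
  under eq_bigr => p _ do under eq_bigr => q _ do rewrite mulrC -scalerA.
  under eq_bigr => p _ do rewrite -scaler_sumr.
  rewrite (@sweedler_counitr _ (fun x => \sum_(q <- comul H b) _ *: S (x * q.1))).
    by rewrite (@sweedler_counitr _ (fun x => S (a * x))) // => c x y; rewrite !linE.
  by apply: linear_bigsum => q c x y; rewrite !linE scalerDr !scalerA mulrC.
apply: eq_bigr => p _; rewrite exchange_big; apply: eq_bigr => q _ /=.
have SG p' : \sum_(q' <- comul H q.2) G p p' q.1 q'.1 q'.2 =
    eps q.2 *: (S (p.1 * q.1) * (p'.1 * S p'.2)).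
  rewrite /G -[p'.1 in RHS]mulr1 scalerAr scalerAl scalerAr -antipoder.
  rewrite mulr_sumr mulr_suml mulr_sumr.
  by apply: eq_bigr => q' _; rewrite !mulrA.
under eq_bigr do rewrite SG.
rewrite -scaler_sumr -mulr_sumr antipoder -scalerAr mulr1.
by rewrite scalerA.
Qed.

Definition sigma (b : A) : enveloping A := tensor 1 b.

Definition rho (a : A) : enveloping A := \sum_(p <- comul H a) tensor p.1 (S p.2).

Fact rho_linear : linear rho.
Proof.
apply: (sweedler_linear (f := fun x y => tensor x (S y))).
by split=> [y c x x'|x c y y'] /=; rewrite !linE.
Qed.

Fact rho_monoid : monoid_morphism rho.
Proof.
have bf : bilinear_for *:%R *:%R (fun x y : A => tensor x (S y)).
  by split=> [y c x x'|x c y y'] /=; rewrite !linE.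
split=> [|a b]; first by rewrite /rho (comul1 H bf) big_seq1 antipode1.
rewrite /rho (comulM H a b bf) big_allpairs_dep mulr_suml; apply: eq_bigr => p _.
by rewrite mulr_sumr; apply: eq_bigr => q _ /=; rewrite antipodeM tensorM.
Qed.

HB.instance Definition _ := GRing.isLinear.Build k A (enveloping A) *:%R rho rho_linear.
HB.instance Definition _ :=
  GRing.isMonoidMorphism.Build A (enveloping A) rho rho_monoid.

Lemma sigma_mul b c : sigma b * sigma c = sigma (c * b).
Proof. by rewrite /sigma tensorM mulr1. Qed.

Lemma sigma_rho a b : sigma b * rho a = \sum_(p <- comul H a) tensor p.1 (S p.2 * b).
Proof. by rewrite mulr_sumr; apply: eq_bigr => p _; rewrite tensorM mul1r. Qed.

Lemma rho_sigma a b : rho a * sigma b = \sum_(p <- comul H a) tensor p.1 (b * S p.2).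
Proof. by rewrite mulr_suml; apply: eq_bigr => p _; rewrite tensorM mulr1. Qed.

(** The right side expands to [x_1 (x) S(x_2) x_3 y], where [S(x_2) x_3] collapses. *)
Lemma tensor_sigma_rho x y :
  tensor x y = \sum_(p <- comul H x) sigma (p.2 * y) * rho p.1.
Proof.
under eq_bigr do rewrite sigma_rho.
rewrite (sweedler_coassoc (f := fun a b c => tensor a (S b * (c * y)))); last first.
  by split=> [b c|a c|a b] z u v; rewrite !linE.
rewrite -[LHS](sweedler_counitr x (f := fun a => tensor a y)); last first.
  by move=> c a b; rewrite !linE.
apply: eq_bigr => p _; rewrite -tensorZr -[y in _ *: y]mul1r scalerAl -antipodel mulr_suml.
rewrite (bigsum_linear _ _ ((tensor_bilinear A).2 p.1)).
by apply: eq_bigr => q _; rewrite mulrA.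
Qed.

(** A factor [rho] on the left puts its antipode to the right of [y], because the second factor
    multiplies in reverse. The sum is thus [x_1 (x) y S^2(x_3) S(x_2)], which collapses as
    [S(x_2 S(x_3))]; this is the origin of the square of the antipode. *)
Lemma tensor_rho_sigma x y :
  tensor x y = \sum_(p <- comul H x) rho p.1 * sigma (y * S (S p.2)).
Proof.
under eq_bigr do rewrite rho_sigma.
rewrite (sweedler_coassoc (f := fun a b c => tensor a (y * S (S c) * S b))); last first.
  by split=> [b c|a c|a b] z u v; rewrite !linE.
rewrite -[LHS](sweedler_counitr x (f := fun a => tensor a y)); last first.
  by move=> c a b; rewrite !linE.
apply: eq_bigr => p _; rewrite -tensorZr -[y in _ *: y]mulr1 scalerAr.
rewrite -antipode1 -SZ -antipoder linear_sum mulr_sumr.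
rewrite (bigsum_linear _ _ ((tensor_bilinear A).2 p.1)).
by apply: eq_bigr => q _; rewrite antipodeM mulrA.
Qed.

(** Freeness of the enveloping algebra as a right [rho(A)]-module, the form suited to rows
    multiplied on the right by [rho(D)]. *)
Lemma sigma_rho_tensor_product :
  tensor_product_map (fun a b => sigma b * rho a).
Proof.
split=> [|t|V f bf].
- split=> [y c x x'|x c y y'] /=; first by rewrite linearP mulrDr -scalerAr.
  by rewrite /sigma tensorDr tensorZr mulrDl -scalerAl.
- have [s ->] := tensor_sum t.
  exists [seq (q.1, q.2 * p.2) | p <- s, q <- comul H p.1].
  by rewrite big_allpairs_dep; apply: eq_bigr => p _; rewrite tensor_sigma_rho.
have fDr x y y' : f x (y + y') = f x y + f x y'.
  by have := bf.2 x 1 y y'; rewrite /= !scale1r.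
have fDl x x' y : f (x + x') y = f x y + f x' y.
  by have := bf.1 y 1 x x'; rewrite /= !scale1r.
have fZl (c : k) x y : f (c *: x) y = c *: f x y by apply: bilinear_scale.
have fZr (c : k) x y : f x (c *: y) = c *: f x y.
  by have [g gE] := linear_of_fun (bf.2 x); rewrite -!gE linearZ.
pose flinE := (linE, fDr, fDl, fZl, fZr).
(* The formula is read off from [tensor_sigma_rho]; on [sigma b * rho a] it gives
   [f(a_1, a_2 S(a_3) b)], which is [f(a, b)]. *)
have [|g gE] := @tensor_lift k A V (fun x y => \sum_(p <- comul H x) f p.1 (p.2 * y)).
  split=> [y|x].
    apply: (sweedler_linear (f := fun u v => f u (v * y))).
    by split=> [v c u u'|u c v v'] /=; rewrite !flinE.
  by apply: linear_bigsum => p c u v; rewrite !flinE.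
exists g => a b; rewrite sigma_rho linear_sum.
under eq_bigr do rewrite gE.
rewrite (sweedler_coassoc (f := fun x y z => f x (y * (S z * b)))); last first.
  by split=> [y z|x z|x y] c u v; rewrite !flinE.
rewrite -[RHS](sweedler_counitr a (f := f^~ b)); last by move=> c x y; rewrite !flinE.
apply: eq_bigr => p _; rewrite -fZr -[b in _ *: b]mul1r scalerAl -antipoder mulr_suml.
rewrite (bigsum_linear _ _ (bf.2 p.1)).
by apply: eq_bigr => q _; rewrite mulrA.
Qed.

(** Freeness as a left [rho(A)]-module, the form suited to columns multiplied on the left by
    [rho(D)]. *)
Lemma rho_sigma_tensor_product :
  tensor_product_map (fun a b => rho a * sigma b).
Proof.
split=> [|t|V f bf].
- split=> [y c x x'|x c y y'] /=; first by rewrite linearP mulrDl -scalerAl.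
  by rewrite /sigma tensorDr tensorZr mulrDr -scalerAr.
- have [s ->] := tensor_sum t.
  exists [seq (q.1, p.2 * S (S q.2)) | p <- s, q <- comul H p.1].
  by rewrite big_allpairs_dep; apply: eq_bigr => p _; rewrite tensor_rho_sigma.
have fDr x y y' : f x (y + y') = f x y + f x y'.
  by have := bf.2 x 1 y y'; rewrite /= !scale1r.
have fDl x x' y : f (x + x') y = f x y + f x' y.
  by have := bf.1 y 1 x x'; rewrite /= !scale1r.
have fZl (c : k) x y : f (c *: x) y = c *: f x y by apply: bilinear_scale.
have fZr (c : k) x y : f x (c *: y) = c *: f x y.
  by have [g gE] := linear_of_fun (bf.2 x); rewrite -!gE linearZ.
pose flinE := (linE, fDr, fDl, fZl, fZr).
(* On [rho a * sigma b] this gives [f(a_1, b S(a_3) S^2(a_2))], and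
   [S(a_3) S^2(a_2) = S(S(a_2) a_3)] collapses. *)
have [|g gE] := @tensor_lift k A V (fun x y => \sum_(p <- comul H x) f p.1 (y * S (S p.2))).
  split=> [y|x].
    apply: (sweedler_linear (f := fun u v => f u (y * S (S v)))).
    by split=> [v c u u'|u c v v'] /=; rewrite !flinE.
  by apply: linear_bigsum => p c u v; rewrite !flinE.
exists g => a b; rewrite rho_sigma linear_sum.
under eq_bigr do rewrite gE.
rewrite (sweedler_coassoc (f := fun x y z => f x (b * S z * S (S y)))); last first.
  by split=> [y z|x z|x y] c u v; rewrite !flinE.
rewrite -[RHS](sweedler_counitr a (f := f^~ b)); last by move=> c x y; rewrite !flinE.
apply: eq_bigr => p _; rewrite -fZr -[b in _ *: b]mulr1 scalerAr.
rewrite -antipode1 -SZ -antipodel linear_sum mulr_sumr.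
rewrite (bigsum_linear _ _ (bf.2 p.1)).
by apply: eq_bigr => q _; rewrite antipodeM mulrA.
Qed.

Section BimoduleAugmentation.
Variable mu : {linear enveloping A -> A}.
Hypothesis muE : forall x y, mu (tensor x y) = x * y.

Lemma mu_tensorM x y t : mu (tensor x y * t) = x * mu t * y.
Proof.
have [s ->] := tensor_sum t; rewrite mulr_sumr !linear_sum mulr_sumr mulr_suml.
by apply: eq_bigr => p _; rewrite tensorM !muE !mulrA.
Qed.

Lemma mu_ker_lmul r t : mu t = 0 -> mu (r * t) = 0.
Proof.
have [s ->] := tensor_sum r; rewrite mulr_suml linear_sum => mut.
by rewrite big1 // => p _; rewrite mu_tensorM mut mulr0 mul0r.
Qed.

(** Right multiplication by [rho a] inserts [a_1 S(a_2)] between the two tensor factors. So [rho] of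
    the augmentation ideal multiplies everything into the kernel of [mu]. *)
Lemma mu_rho t a : mu (t * rho a) = eps a *: mu t.
Proof.
have [s ->] := tensor_sum t; rewrite mulr_suml !linear_sum; apply: eq_bigr => p _.
rewrite mulr_sumr linear_sum muE -[p.1 in RHS]mulr1 /= scalerAl scalerAr -antipoder.
by rewrite mulr_sumr mulr_suml; apply: eq_bigr => q _; rewrite tensorM muE !mulrA.
Qed.

End BimoduleAugmentation.

End HopfTheory.

Lemma mu_exists (k : fieldType) (A : algType k) :
  exists mu : {linear enveloping A -> A}, forall x y, mu (tensor x y) = x * y.
Proof.
apply: tensor_lift; split=> [y c x x'|x c y y'] /=; first by rewrite mulrDl -scalerAl.
by rewrite mulrDr -scalerAr.
Qed.

(** * The co-opposite Hopf algebra *)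

Section Coopposite.
Variables (k : fieldType) (A : algType k) (H : hopf_algebra A).
Variable S' : {linear A -> A}.
Hypotheses (SK : cancel (antipode H) S') (S'K : cancel S' (antipode H)).

Definition coopposite_comul (a : A) : seq (A * A) := [seq (p.2, p.1) | p <- comul H a].

Lemma bilinear_flip (V : lmodType k) (f : A -> A -> V) :
  bilinear_for *:%R *:%R f -> bilinear_for *:%R *:%R (fun x y => f y x).
Proof. by move=> [fl fr]; split=> [x|y]; [apply: fr | apply: fl]. Qed.

Fact coopposite_linear (c : k) a b :
  tensor2_eq (coopposite_comul (c *: a + b))
    ([seq (c *: p.1, p.2) | p <- coopposite_comul a] ++ coopposite_comul b).
Proof.
move=> V f bf; have := comul_linear H c a b (bilinear_flip bf).
rewrite !big_cat /= !big_map /= => ->; congr (_ + _); apply: eq_bigr => p _ /=.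
by rewrite (bilinear_scale _ bf) (bilinear_scale _ (bilinear_flip bf)).
Qed.

Fact coopposite1 : tensor2_eq (coopposite_comul 1) [:: (1, 1)].
Proof.
by move=> V f bf; have := comul1 H (bilinear_flip bf); rewrite big_map !big_seq1.
Qed.

Fact cooppositeM a b : tensor2_eq (coopposite_comul (a * b))
  [seq (p.1 * q.1, p.2 * q.2) | p <- coopposite_comul a, q <- coopposite_comul b].
Proof.
move=> V f bf; have := comulM H a b (bilinear_flip bf).
rewrite big_map !big_allpairs_dep !big_map /= => ->.
by apply: eq_bigr => p _; rewrite big_map.
Qed.

Fact cooppositeA a : tensor3_eq
  [seq (q.1, q.2, p.2) | p <- coopposite_comul a, q <- coopposite_comul p.1]
  [seq (p.1, q.1, q.2) | p <- coopposite_comul a, q <- coopposite_comul p.2].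
Proof.
move=> V f [f1 f2 f3]; rewrite !big_allpairs_dep !big_map /=.
under eq_bigr do rewrite big_map /=.
under [RHS]eq_bigr do rewrite big_map /=.
apply/esym/(@sweedler_coassoc k A H V (fun x y z => f z y x)); split=> *; [apply: f3|apply: f2|apply: f1].
Qed.

Fact coopposite_counitl a :
  \sum_(p <- coopposite_comul a) (counit H p.1 : k) *: p.2 = a.
Proof. by rewrite big_map; apply: counitr. Qed.

Fact coopposite_counitr a :
  \sum_(p <- coopposite_comul a) (counit H p.2 : k) *: p.1 = a.
Proof. by rewrite big_map; apply: counitl. Qed.

(** The map [S] is injective and antimultiplicative, and it turns [S^-1(a_2) a_1] into
    [S(a_1) a_2]. *)
Fact coopposite_antipodel a :
  \sum_(p <- coopposite_comul a) S' p.1 * p.2 = (counit H a : k)%:A.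
Proof.
apply: (can_inj SK); rewrite big_map linear_sum linearZ /= antipode1 -antipodel.
by apply: eq_bigr => p _; rewrite antipodeM S'K.
Qed.

Fact coopposite_antipoder a :
  \sum_(p <- coopposite_comul a) p.1 * S' p.2 = (counit H a : k)%:A.
Proof.
apply: (can_inj SK); rewrite big_map linear_sum linearZ /= antipode1 -antipoder.
by apply: eq_bigr => p _; rewrite antipodeM S'K.
Qed.

Definition coopposite : hopf_algebra A := @HopfAlgebra k A coopposite_comul (counit H) S'
  coopposite_linear coopposite1 cooppositeM cooppositeA
  coopposite_counitl coopposite_counitr coopposite_antipodel coopposite_antipoder.

(** This is how [phi] enters: one statement about left windings, applied to both structures, yields
    [xi] and [phi]. *)
Lemma left_winding_coopposite (chi : {lrmorphism A -> k^o}) a :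
  left_winding coopposite chi a = right_winding H chi a.
Proof. by rewrite /left_winding big_map. Qed.

End Coopposite.

(** * Invertibility of the winding maps *)

Section WindingTwist.
Variables (k : fieldType) (A : algType k) (H : hopf_algebra A).
Variable chi : {lrmorphism A -> k^o}.

(** Left windings compose by convolution of functionals, and [chi] composed with the antipode is the
    convolution inverse of [chi]; winding by it is the inverse map. *)
Lemma left_winding_bijective : bijective (left_winding H chi).
Proof.
have chiP (c : k) x y : (chi (c *: x + y) : k) = c * (chi x : k) + chi y.
  by rewrite linearP.
have convolve (f g : A -> k) a :
    (forall c x y, f (c *: x + y) = c * f x + f y) ->
    (forall c x y, g (c *: x + y) = c * g x + g y) ->
    \sum_(p <- comul H (\sum_(p <- comul H a) f p.1 *: p.2)) g p.1 *: p.2 =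
    \sum_(p <- comul H a) (\sum_(q <- comul H p.1) f q.1 * g q.2) *: p.2.
  move=> fP gP.
  have gl : linear (fun a => \sum_(p <- comul H a) g p.1 *: p.2).
    apply: (@sweedler_linear k A H A (fun x y => g x *: y)).
    split=> [y c x x'|x c y y'] /=; first by rewrite gP scalerDl scalerA.
    by rewrite scalerDr !scalerA mulrC.
  rewrite (bigsum_linear _ _ gl).
  under [RHS]eq_bigr do rewrite scaler_suml.
  rewrite (@sweedler_coassoc k A H A (fun x y z => (f x * g y) *: z)).
    apply: eq_bigr => p _; have [h hE] := linear_of_fun gl.
    rewrite -hE linearZ /= hE scaler_sumr.
    by apply: eq_bigr => q _; rewrite scalerA.
  split=> [y z|x z|x y] c u v.
  - by rewrite fP mulrDl scalerDl !scalerA mulrA.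
  - by rewrite gP mulrDr scalerDl !scalerA mulrCA.
  - by rewrite scalerDr !scalerA mulrC.
have chiSP (c : k) x y :
    (chi (antipode H (c *: x + y)) : k) = c * (chi (antipode H x) : k) + chi (antipode H y).
  by rewrite !linearP.
have chi_eps (c : k) : (chi c%:A : k) = c by rewrite linearZ rmorph1; apply: mulr1.
exists (fun a => \sum_(p <- comul H a) (chi (antipode H p.1) : k) *: p.2) => a.
  rewrite [LHS](convolve (fun x => chi x : k) (fun x => chi (antipode H x) : k)) // -[RHS](counitl H); apply: eq_bigr => p _; congr (_ *: _).
  rewrite -[RHS]chi_eps -antipoder linear_sum.
  by apply: eq_bigr => q _; rewrite rmorphM.
rewrite [LHS](convolve (fun x => chi (antipode H x) : k) (fun x => chi x : k)) // -[RHS](counitl H); apply: eq_bigr => p _; congr (_ *: _).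
rewrite -[RHS]chi_eps -antipodel linear_sum.
by apply: eq_bigr => q _; rewrite rmorphM.
Qed.

End WindingTwist.

(** * Extension of scalars along a tensor product *)

Section RestrictScalars.
Variables (k : fieldType) (A : algType k).

(** A matrix space over [A] comes as an [A]-module; the alias lets it also carry the restricted
    [k]-structure, in which splittings exist. *)
Definition kmod (V : lmodType A) : Type := V.

Variable V : lmodType A.
HB.instance Definition _ := GRing.Zmodule.on (kmod V).

Definition kmod_scale (c : k) (v : kmod V) : kmod V := (c%:A : A) *: (v : V).

Fact kmod_scaleA b c v : kmod_scale b (kmod_scale c v) = kmod_scale (b * c) v.
Proof. by rewrite /kmod_scale scalerA -scalerAl mul1r scalerA. Qed.

Fact kmod_scale1 : left_id 1 kmod_scale.
Proof. by move=> v; rewrite /kmod_scale !scale1r. Qed.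

Fact kmod_scaleDr : right_distributive kmod_scale +%R.
Proof. by move=> c u v; rewrite /kmod_scale; apply: scalerDr. Qed.

Fact kmod_scaleDl v : {morph kmod_scale^~ v : b c / b + c}.
Proof. by move=> b c; rewrite /kmod_scale scalerDl; apply: scalerDl. Qed.

HB.instance Definition _ := GRing.Zmodule_isLmodule.Build k (kmod V)
  kmod_scaleA kmod_scale1 kmod_scaleDr kmod_scaleDl.

End RestrictScalars.

Lemma kmod_mxE (k : fieldType) (A : algType k) p q (c : k)
  (M : kmod ('M[A]_(p, q) : lmodType A)) i j :
  ((c *: M) : 'M[A]_(p, q)) i j = c *: ((M : 'M[A]_(p, q)) i j).
Proof. by rewrite [LHS]mxE -scalerAl mul1r. Qed.

Lemma kmod_mx_linE (k : fieldType) (A : algType k) p q (c : k)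
  (M N : kmod ('M[A]_(p, q) : lmodType A)) i j :
  ((c *: M + N) : 'M[A]_(p, q)) i j = c *: ((M : 'M[A]_(p, q)) i j) + (N : 'M[A]_(p, q)) i j.
Proof. by rewrite [LHS]mxE kmod_mxE. Qed.

Section Transport.
Variables (k : fieldType) (A T : algType k) (tau : A -> A -> T).
Hypothesis tauP : tensor_product_map tau.

Local Notation kMA p q := (kmod ('M[A]_(p, q) : lmodType A)).
Local Notation kMT p q := (kmod ('M[T]_(p, q) : lmodType T)).

(** The pure tensor of [M] and [b] when matrices over [T] are viewed as matrices over [A] tensored
    with [A]. *)
Definition tensor_mx p q (M : 'M[A]_(p, q)) (b : A) : 'M[T]_(p, q) :=
  map_mx (tau^~ b) M.

Lemma tensor_mx_bilinear p q (M : 'M[A]_(p, q)) (c : k) b b' :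
  tensor_mx M (c *: b + b') = (c *: (tensor_mx M b : kMT p q) + (tensor_mx M b' : kMT p q)).
Proof.
have [[_ tau_r] _ _] := tauP.
by apply/matrixP => i j; rewrite [RHS]kmod_mx_linE !mxE tau_r.
Qed.

Lemma tensor_mx_linear p q b : linear (fun M : kMA p q => tensor_mx M b : kMT p q).
Proof.
have [[tau_l _] _ _] := tauP => c M N.
by apply/matrixP => i j; rewrite [RHS]kmod_mx_linE ![tensor_mx _ _ _ _]mxE kmod_mx_linE tau_l.
Qed.

Lemma tensor_mxD p q b (M N : 'M[A]_(p, q)) :
  tensor_mx (M + N) b = tensor_mx M b + tensor_mx N b.
Proof.
by have := @tensor_mx_linear p q b 1 M N; rewrite /= !scale1r.
Qed.

Lemma tensor_mx_ext p q (W : zmodType) (F G : 'M[T]_(p, q) -> W) :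
  {morph F : M N / M + N} -> {morph G : M N / M + N} ->
  (forall M b, F (tensor_mx M b) = G (tensor_mx M b)) -> F =1 G.
Proof.
move=> FD GD FG M.
have morph0 (h : 'M[T]_(p, q) -> W) : {morph h : M N / M + N} -> h 0 = 0.
  by move=> hD; apply: (addrI (h 0)); rewrite -hD !addr0.
have FGsum I (r : seq I) (N : I -> 'M[T]_(p, q)) :
    (forall i, F (N i) = G (N i)) -> F (\sum_(i <- r) N i) = G (\sum_(i <- r) N i).
  move=> FGN; rewrite (big_morph F FD (morph0 F FD)) (big_morph G GD (morph0 G GD)).
  exact: eq_bigr.
have [[tau_l _] tau_gen _] := tauP.
have tau0 b : tau 0 b = 0 by have := tau_l b (-1) 0 0; rewrite /= scaler0 add0r scaleN1r addNr.
rewrite (matrix_sum_delta M); apply: (FGsum) => i; apply: (FGsum) => j.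
have [s ->] := tau_gen (M i j); rewrite scaler_suml; apply: (FGsum) => ab.
have -> : tau ab.1 ab.2 *: delta_mx i j = tensor_mx (ab.1 *: delta_mx i j) ab.2.
  apply/matrixP => i' j'; rewrite !mxE; case: (_ && _); first by rewrite !mulr1.
  by rewrite !mulr0 tau0.
exact: FG.
Qed.

(** [F] is [f] tensored with the identity. Only [k]-linearity of [f] is asked, so that
    pseudo-inverses extend as well as differentials. *)
Lemma tensor_mx_extend p q r s (f : {linear kMA p q -> kMA r s}) :
  exists F : {linear kMT p q -> kMT r s}, forall M b,
    F (tensor_mx M b) = tensor_mx (f M) b.
Proof.
have [_ _ tau_lift] := tauP.
pose phi i j (a b : A) : kMT r s := tensor_mx (f (a *: delta_mx i j : 'M[A]_(p, q))) b.
have /choice [L LP] (ij : 'I_p * 'I_q) : exists g : {linear T -> kMT r s},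
    forall a b, g (tau a b) = phi ij.1 ij.2 a b.
  apply: tau_lift; split=> [b c a a'|a c b b'] /=; last by rewrite /phi tensor_mx_bilinear.
  rewrite /phi -[RHS]tensor_mx_linear -linearP; congr (tensor_mx (f _) b).
  by apply/matrixP => i' j'; rewrite [RHS]kmod_mx_linE !mxE mulrDl scalerAl.
pose F (M : kMT p q) : kMT r s := \sum_i \sum_j L (i, j) ((M : 'M[T]_(p, q)) i j).
have [|G GE] := @linear_of_fun _ _ _ F.
  move=> c M N; rewrite /F scaler_sumr -big_split; apply: eq_bigr => i _.
  rewrite scaler_sumr -big_split; apply: eq_bigr => j _ /=.
  by rewrite [in LHS]kmod_mx_linE linearP.
exists G => M b; rewrite GE /F {2}(matrix_sum_delta M).
rewrite linear_sum (bigsum_linear _ _ (tensor_mx_linear b)); apply: eq_bigr => i _.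
rewrite linear_sum (bigsum_linear _ _ (tensor_mx_linear b)); apply: eq_bigr => j _.
by rewrite mxE LP.
Qed.

(** With pseudo-inverses [f'] and [g'] and [h = f' (id - g' g)], exactness gives [id = f h + g' g].
    Each map extends to [T], hence so does the identity; where [G] vanishes it reads
    [y = F (Hx y)]. *)
Lemma tensor_mx_exact p q r s t u
  (f : {linear kMA p q -> kMA r s}) (g : {linear kMA r s -> kMA t u})
  (F : {linear kMT p q -> kMT r s}) (G : {linear kMT r s -> kMT t u}) :
  (forall M b, F (tensor_mx M b) = tensor_mx (f M) b) ->
  (forall M b, G (tensor_mx M b) = tensor_mx (g M) b) ->
  (forall y, g y = 0 -> exists x, y = f x) ->
  forall y, G y = 0 -> exists x, y = F x.
Proof.
move=> FE GE fg_exact y Gy.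
have [f' f'P] := linear_pseudo_inverse f.
have [g' g'P] := linear_pseudo_inverse g.
have [h hE] : exists h : {linear kMA r s -> kMA p q}, forall y, h y = f' (y - g' (g y)).
  by exists (f' \o (idfun \- (g' \o g))).
have decomp v : v = f (h v) + g' (g v).
  have [|x Ex] := fg_exact (v - g' (g v)); first by rewrite linearB g'P subrr.
  by rewrite hE Ex f'P -Ex subrK.
have [Hx HxE] := tensor_mx_extend h; have [G' G'E] := tensor_mx_extend g'.
exists (Hx y).
have E M b : idfun (tensor_mx M b) = (F \o Hx \+ (G' \o G)) (tensor_mx M b) :> 'M[T]_(r, s).
  by rewrite /= HxE FE GE G'E -tensor_mxD -decomp.
have /= := tensor_mx_ext _ _ E y; rewrite Gy linear0 addr0; apply=> // M N.
exact: (linearD (F \o Hx \+ (G' \o G))).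
Qed.

End Transport.

(** * Noetherian modules *)

Section FinitelyGenerated.
Variable R : nzRingType.
Implicit Types K V W : lmodType R.

Definition submodule V (N : V -> Prop) :=
  N 0 /\ forall a x y, N x -> N y -> N (a *: x + y).

Fixpoint span V (s : seq V) (x : V) : Prop :=
  if s is y :: s' then exists c, span s' (x - c *: y) else x = 0.

Definition noetherian_module V := forall N : V -> Prop, submodule N ->
  exists s, (forall y, y \in s -> N y) /\ forall x, N x -> span s x.

Lemma span_submodule V (s : seq V) : submodule (span s).
Proof.
elim: s => [|y s [IH0 IHlin]]; split=> //=.
- by move=> a x z -> ->; rewrite scaler0 addr0.
- by exists 0; rewrite scale0r subr0.
move=> a x z [c xc] [e ze]; exists (a * c + e).
rewrite scalerDl opprD addrACA -scalerA -scalerBr; exact: IHlin.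
Qed.

Lemma submodule_span V (s : seq V) (N : V -> Prop) : submodule N ->
  (forall y, y \in s -> N y) -> forall x, span s x -> N x.
Proof.
move=> [N0 Nlin]; elim: s => [_ x -> //|y s IHs sN x [c xc]].
rewrite -(subrK (c *: y) x) addrC; apply: Nlin; first by apply: sN; rewrite mem_head.
by apply: IHs xc => z zs; apply: sN; rewrite inE zs orbT.
Qed.

Lemma span_cat V (s t : seq V) x y : span s y -> span t (x - y) -> span (s ++ t) x.
Proof.
elim: s x y => [x y -> /=|z s IHs x y /= [c yc] xy]; first by rewrite subr0.
by exists c; apply: IHs yc _; rewrite opprB addrA subrK.
Qed.

Lemma span_map V W (f : {linear V -> W}) (s : seq V) x :
  span s x -> span (map f s) (f x).
Proof.
elim: s x => [x -> /=|y s IHs x /= [c xc]]; first by rewrite linear0.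
by exists c; rewrite -linearZ_LR -linearB; apply: IHs.
Qed.

Lemma span_lift V W (f : {linear V -> W}) (s : seq V) y :
  span (map f s) y -> exists x, span s x /\ f x = y.
Proof.
elim: s y => [y -> /=|z s IHs y /= [c /IHs [x [sx fx]]]].
  by exists 0; rewrite linear0.
exists (x + c *: z); split; last by rewrite linearD linearZ_LR fx subrK.
by exists c; rewrite addrK.
Qed.

(** Generators of [N] are lifts to [N] of generators of [f(N)] together with the images of
    generators of the preimage of [N] under [i]. *)
Lemma noetherian_extension K V W (i : {linear K -> V}) (f : {linear V -> W}) :
  (forall x, f x = 0 -> exists y, x = i y) ->
  noetherian_module K -> noetherian_module W -> noetherian_module V.
Proof.
move=> fi Kfg Wfg N [N0 Nlin].
have [|s [sN sgen]] := Wfg (fun w => exists2 v, N v & f v = w).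
  split; first by exists 0; rewrite ?linear0.
  by move=> a _ _ [v Nv <-] [v' Nv' <-]; exists (a *: v + v'); rewrite ?linearP //; apply: Nlin.
have [|t [tN tgen]] := Kfg (fun y => N (i y)).
  by split=> [|a x y]; rewrite ?linear0 ?linearP //; apply: Nlin.
have [s' [s'N s's]] : exists s', (forall v, v \in s' -> N v) /\ map f s' = s.
  elim: s {sgen} sN => [_|w s IHs sN]; first by exists [::].
  have [s' [s'N <-]] : exists s', (forall v, v \in s' -> N v) /\ map f s' = s.
    by apply: IHs => y ys; apply: sN; rewrite inE ys orbT.
  have [v Nv <-] := sN w (mem_head _ _).
  by exists (v :: s'); split=> // u; rewrite inE => /predU1P[->|/s'N].
exists (s' ++ map i t); split=> [v|x Nx].
  by rewrite mem_cat => /orP[/s'N //|/mapP[y /tN Ny ->]].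
have [x' [s'x' fx']] : exists x', span s' x' /\ f x' = f x.
  by apply: span_lift; rewrite s's; apply: sgen; exists x.
have [|y xy] := fi (x - x'); first by rewrite linearB fx' subrr.
apply: (span_cat s'x'); rewrite xy; apply: span_map; apply: tgen; rewrite -xy.
rewrite addrC -scaleN1r; apply: (Nlin) => //.
exact: (submodule_span (conj N0 Nlin) s'N s'x').
Qed.

(** If a submodule were not finitely generated, repeatedly adjoining an element outside the current
    span would give a strictly increasing chain. *)
Lemma noetherian_regular : left_noetherian R -> noetherian_module R^o.
Proof.
move=> acc N Nsub; apply: contrapT => not_fg.
(* The condition that [s] lies in [N] stands below the existential, which makes [next] a total
   function on lists. *)
have /choice [next nextP] (s : seq R^o) : exists x, (forall y, y \in s -> N y) ->
    N x /\ ~ span s x.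
  apply: contrapT => stuck; apply: not_fg; exists s.
  have sN : forall y, y \in s -> N y.
    by move=> y ys; apply: contrapT => Ny; apply: stuck; exists y => /(_ y ys).
  split=> // x Nx; apply: contrapT => x_out; by apply: stuck; exists x.
pose chain n := iter n (fun s => next s :: s) [::].
have chainN n y : y \in chain n -> N y.
  elim: n y => [//|n IHn] y /=; rewrite inE => /predU1P[->|/IHn //].
  by apply: (nextP _ _).1.
have span_cons (y : R^o) s x : span s x -> span (y :: s) x.
  by move=> sx; exists 0; rewrite scale0r subr0.
have [||n stable] := acc (fun n => [pred x | `[< span (chain n) x >]]).
- move=> n; split=> [|a x y]; rewrite !inE; first exact: (span_submodule _).1.
  exact: (span_submodule _).2.
- by move=> n x; rewrite !inE; apply: span_cons.
have [_] := nextP (chain n) (chainN n); apply.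
have := stable n.+1 (leqnSn n) (next (chain n)); rewrite !inE => E.
suff: span (chain n.+1) (next (chain n)) by move=> /asboolP; rewrite E => /asboolP.
by exists 1; rewrite scale1r subrr; apply: (span_submodule _).1.
Qed.

Lemma noetherian_row n : left_noetherian R -> noetherian_module 'rV[R]_n.
Proof.
move=> noethR; elim: n => [|n IHn].
  move=> N _; exists [::]; split=> // x _; exact: thinmx0.
have [|i iE] := @linear_of_fun R 'rV[R]_n 'rV[R]_n.+1 (fun x => row_mx (0 : 'rV_1) x).
  move=> a x y; apply/rowP => j; rewrite !mxE; case: splitP => j' _; rewrite !mxE //.
  by rewrite mulr0 addr0.
have [|f fE] := @linear_of_fun R 'rV[R]_n.+1 R^o (fun x => x 0 0).
  by move=> a x y; rewrite !mxE.
apply: (@noetherian_extension _ _ _ i f) IHn (noetherian_regular noethR) => x.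
rewrite fE => x0; exists (rsubmx (x : 'rV_(1 + n))); rewrite iE.
rewrite -[LHS](@hsubmxK _ _ 1 n); suff -> : lsubmx (x : 'rV_(1 + n)) = 0 by [].
by apply/rowP => j; rewrite ord1 !mxE -[RHS]x0; congr (x _ _); apply: val_inj.
Qed.

Lemma span_mulmx n (s : seq 'rV[R]_n) :
  exists m (G : 'M[R]_(m, n)), forall x, span s x <-> exists y, x = y *m G.
Proof.
elim: s => [|g s [m [G GP]]].
  exists 0, 0 => x; split=> [->|[y ->]]; first by exists 0; rewrite mulmx0.
  by rewrite /= mulmx0.
exists (1 + m)%N, (col_mx g G) => x; split=> [[c /GP [y xy]]|[y ->]].
  exists (row_mx c%:M y); rewrite mul_row_col mul_scalar_mx -xy.
  by rewrite addrC subrK.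
rewrite -(hsubmxK y) mul_row_col; exists (lsubmx y 0 0); apply/GP; exists (rsubmx y).
by rewrite {1}[lsubmx y]mx11_scalar mul_scalar_mx addrC addKr.
Qed.

Lemma noetherian_row_generators n (N : 'rV[R]_n -> Prop) :
  left_noetherian R -> submodule N ->
  exists m (G : 'M[R]_(m, n)), forall x, N x <-> exists y, x = y *m G.
Proof.
move=> noethR Nsub; have [s [sN sgen]] := noetherian_row noethR Nsub.
have [m [G GP]] := span_mulmx s; exists m, G => x; split=> [/sgen/GP //|/GP].
exact: submodule_span.
Qed.

End FinitelyGenerated.

(** * Resolutions *)

(** The rank in degree 0 is 1 by computation, since the module resolved is the cyclic module [R/L];
    [tail] lists the ranks from degree 1 on. *)
Definition resolution_size (tail : nat -> nat) (i : nat) : nat :=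
  if i is j.+1 then tail j else 1%N.

Record free_resolution (R : nzRingType) (L : R -> Prop) := FreeResolution {
  fres_tail : nat -> nat;
  fres_d : forall i, 'M[R]_(fres_tail i, resolution_size fres_tail i);
  fres_exact0 : forall x : 'rV[R]_1, L (x 0 0) <-> exists y, x = y *m fres_d 0;
  fres_exact : forall i (x : 'rV[R]_(fres_tail i)),
    x *m fres_d i = 0 <-> exists y, x = y *m fres_d i.+1
}.

Lemma free_resolution_exists (R : nzRingType) (L : R -> Prop) :
  left_noetherian R -> submodule (L : R^o -> Prop) -> exists F : free_resolution L, True.
Proof.
move=> noethR [L0 Llin].
have [|m0 [D0 D0P]] := @noetherian_row_generators R 1 (fun x => L (x 0 0)) noethR.
  by split=> [|a x y Lx Ly]; rewrite !mxE //; apply: Llin.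
(* The shape of each differential is known only once the previous one is built, so it is stored with
   the matrix. *)
pose stage := {p : nat & {q : nat & 'M[R]_(p, q)}}.
have next_sig (D : stage) : {D' : {r : nat & 'M[R]_(r, projT1 D)} |
    forall x : 'rV_(projT1 D), x *m projT2 (projT2 D) = 0 <-> exists y, x = y *m projT2 D'}.
  apply: cid; have [|r [G GP]] := @noetherian_row_generators R _ (fun x => x *m projT2 (projT2 D) = 0) noethR.
    split=> [|a x y xD yD]; first by rewrite mul0mx.
    by rewrite mulmxDl -scalemxAl xD yD scaler0 addr0.
  by exists (existT _ r G).
pose next D := sval (next_sig D); have nextP D := svalP (next_sig D).
pose step (D : stage) : stage :=
  existT _ (projT1 (next D)) (existT _ (projT1 D) (projT2 (next D))).
pose stages i := iter i step (existT _ m0 (existT _ 1%N D0)).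
pose tail i := projT1 (stages i).
pose d i : 'M[R]_(tail i, resolution_size tail i) :=
  match i with 0 => D0 | j.+1 => projT2 (next (stages j)) end.
(* The number of columns stored in stage [i] agrees with [resolution_size tail i] only after a case
   split on [i]. *)
have dE i (x : 'rV_(tail i)) : x *m projT2 (projT2 (stages i)) = 0 <-> x *m d i = 0 by case: i x.
exists (@FreeResolution R L tail d D0P
  (fun i x => iff_trans (iff_sym (dE i x)) (nextP (stages i) x))) => //.
Qed.

Section FreeModules.
Variable R : nzRingType.

Lemma free_projective n : projective 'rV[R]_n.
Proof.
move=> M N g f g_surj.
have /choice [m mP] (i : 'I_n) : exists x, g x = f (delta_mx 0 i) by apply: g_surj.
have [|h hE] := @linear_of_fun R 'rV[R]_n M (fun x => \sum_i x 0 i *: m i).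
  move=> a x y; rewrite scaler_sumr -big_split; apply: eq_bigr => i _ /=.
  by rewrite !mxE scalerDl scalerA.
exists h => x; rewrite hE linear_sum [in RHS](row_sum_delta x) linear_sum.
by apply: eq_bigr => i _; rewrite !linearZ_LR mP.
Qed.

Lemma row_linearE n (phi : {linear 'rV[R]_n -> R^o}) :
  exists v : 'cV[R]_n, forall x, phi x = (x *m v) 0 0.
Proof.
exists (\col_i phi (delta_mx 0 i)) => x; rewrite [in LHS](row_sum_delta x) linear_sum mxE.
by apply: eq_bigr => i _; rewrite linearZ_LR mxE.
Qed.

Lemma col_linear n (v : 'cV[R]_n) :
  exists phi : {linear 'rV[R]_n -> R^o}, forall x, phi x = (x *m v) 0 0.
Proof.
have [|phi phiE] := @linear_of_fun R 'rV[R]_n R^o (fun x => (x *m v) 0 0); last by exists phi.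
by move=> a x y; rewrite mulmxDl -scalemxAl !mxE.
Qed.

Lemma col_ext n (v w : 'cV[R]_n) :
  (forall x : 'rV_n, (x *m v) 0 0 = (x *m w) 0 0) -> v = w.
Proof.
move=> vw; apply/colP => i; have := vw (delta_mx 0 i).
by rewrite -!rowE !mxE.
Qed.

Lemma row_linear_mx m n (f : {linear 'rV[R]_m -> 'rV[R]_n}) :
  exists U : 'M[R]_(m, n), forall x, f x = x *m U.
Proof.
exists (\matrix_i f (delta_mx 0 i)) => x.
rewrite [in LHS](row_sum_delta x) linear_sum mulmx_sum_row.
by apply: eq_bigr => i _; rewrite linearZ_LR rowK.
Qed.

Variables (L : R -> Prop) (F : free_resolution L).
Variables (M : lmodType R) (aug : {linear 'rV[R]_1 -> M}).
Hypothesis aug_surj : forall y, exists x, aug x = y.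
Hypothesis aug_ker : forall x, aug x = 0 <-> L (x 0 0).

(** The module enters only through an augmentation with kernel [L], so the construction serves the
    trivial module as well as the quotient [R/L] itself. *)
Definition free_proj_resolution : proj_resolution M :=
  @ProjResolution R M (fun i => 'rV[R]_(resolution_size (fres_tail F) i))
    (fun i => mulmxr (fres_d F i)) aug (fun i => @free_projective _) aug_surj
    (fun x => iff_trans (aug_ker x) (@fres_exact0 _ _ F x)) (@fres_exact _ _ F).

End FreeModules.

(** * Comparison of projective resolutions and of their cochains *)

Section Comparison.
Variable R : nzRingType.

Section Lifting.
Variables (M : lmodType R) (P : proj_resolution M).

(** The map leaving degree [i], with its target packed alongside; it is the augmentation when [i] is
    0, so that lifting arguments treat all degrees alike. *)
Definition pres_prev i : {V : lmodType R & {linear P i -> V}} :=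
  match i return {V : lmodType R & {linear P i -> V}} with
  | 0 => existT _ M (pres_aug P)
  | j.+1 => existT _ (P j) (pres_d P j)
  end.

Lemma pres_prev_exact i x : projT2 (pres_prev i) x = 0 <-> exists y, x = pres_d P i y.
Proof. by case: i x => [|i] x; [apply: pres_exact0|apply: pres_exact]. Qed.

Lemma pres_dd i x : projT2 (pres_prev i) (pres_d P i x) = 0.
Proof. by apply/pres_prev_exact; exists x. Qed.

(** Projectivity lifts along surjections, and the differential is onto only the kernel of the next
    map. Both [f] and the differential are therefore corestricted to that kernel. *)
Lemma pres_lift i (V : lmodType R) (f : {linear V -> P i}) : projective V ->
  (forall x, projT2 (pres_prev i) (f x) = 0) ->
  exists g : {linear V -> P i.+1}, forall x, pres_d P i (g x) = f x.
Proof.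
move=> projV fP; pose h := projT2 (pres_prev i).
have [|||f' f'E] := @linear_choice R V (kernel h) (fun x y => kernel_val y = f x).
- by move=> x; have hx : f x \in kernel_pred h; [rewrite inE; apply/eqP|exists (Kernel hx)].
- by move=> x y y' <- /val_inj.
- by move=> a x x' y y' fx fx'; rewrite linearP -fx -fx'.
have [|||g gE] := @linear_choice R (P i.+1) (kernel h) (fun x y => kernel_val y = pres_d P i x).
- move=> x; have hx : pres_d P i x \in kernel_pred h by rewrite inE; apply/eqP/pres_dd.
  by exists (Kernel hx).
- by move=> x y y' <- /val_inj.
- by move=> a x x' y y' dx dx'; rewrite linearP -dx -dx'.
have [|l lE] := projV _ _ g f'.
  move=> y; have /pres_prev_exact [x yx] : h (kernel_val y) = 0.
    by case: y => y /=; rewrite inE => /eqP.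
  by exists x; apply: val_inj; rewrite /= gE yx.
by exists l => x; rewrite -gE lE f'E.
Qed.

End Lifting.

Lemma chain_map_exists (M : lmodType R) (P P' : proj_resolution M) :
  exists f : forall i, {linear P i -> P' i},
    (forall x, pres_aug P' (f 0 x) = pres_aug P x) /\
    (forall i x, pres_d P' i (f i.+1 x) = f i (pres_d P i x)).
Proof.
(* Sending cycles to cycles is the invariant of the recursion: it is what makes [f d] liftable in
   the next degree. *)
pose good i (f : {linear P i -> P' i}) :=
  forall x, projT2 (pres_prev P i) x = 0 -> projT2 (pres_prev P' i) (f x) = 0.
have [f0 f0E] := @pres_projective _ _ P 0 _ _ _ (pres_aug P) (@pres_aug_surj _ _ P').
have good0 : good 0%N f0 by move=> x /=; rewrite f0E.
have step i (f : {f : {linear P i -> P' i} | good i f}) :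
    {f' : {linear P i.+1 -> P' i.+1} | good i.+1 f' /\
      forall x, pres_d P' i (f' x) = sval f (pres_d P i x)}.
  apply: cid; case: f => f fP.
  have [|f' f'E] := @pres_lift _ P' i _ (f \o pres_d P i) (@pres_projective _ _ P i.+1).
    by move=> x; apply/fP/pres_dd.
  by exists f'; split=> // x /= dx; rewrite f'E /= dx linear0.
pose fs := fix fs i : {f : {linear P i -> P' i} | good i f} :=
  match i with
  | 0 => exist _ f0 good0
  | j.+1 => let: exist f' f'P := step j (fs j) in exist _ f' f'P.1
  end.
exists (fun i => sval (fs i)); split=> // i x /=.
by case: (step i (fs i)) => f' [? f'E] /=.
Qed.

(** This is the usual [w - id = d s + s d]. The second summand is called [e] because in degree 0
    there is no lower homotopy and it is just 0. The next [s] lifts [w - id - s d], a cycle because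
    [e d = 0]. *)
Lemma chain_homotopy (M : lmodType R) (P : proj_resolution M)
  (w : forall i, {linear P i -> P i}) :
  (forall x, pres_aug P (w 0 x) = pres_aug P x) ->
  (forall i x, pres_d P i (w i.+1 x) = w i (pres_d P i x)) ->
  forall i, exists (s : {linear P i -> P i.+1}) (e : {linear P i -> P i}),
    (forall x, w i x - x = pres_d P i (s x) + e x) /\
    match i return {linear P i -> P i} -> Prop with
    | 0 => fun e => forall x, e x = 0
    | j.+1 => fun e => exists t : {linear P j -> P j.+1}, forall x, e x = t (pres_d P j x)
    end e.
Proof.
move=> w_aug w_d; elim=> [|i [s [e [sE eE]]]].
  have [|s sE] := @pres_lift _ P 0 _ (w 0 \- idfun) (@pres_projective _ _ P 0).
    by move=> x; rewrite linearB /= w_aug subrr.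
  by exists s, \0; split=> // x; rewrite sE /= addr0.
have ed x : e (pres_d P i x) = 0.
  case: i e eE {w_d s sE} x => [|i] e eE x; first exact: eE.
  by have [t ->] := eE; have := pres_dd x; rewrite /= => ->; rewrite linear0.
have [|s' s'E] := @pres_lift _ P i.+1 _ ((w i.+1 \- idfun) \- (s \o pres_d P i))
    (@pres_projective _ _ P i.+1).
  move=> x /=; rewrite !linearB /= w_d sE ed addr0.
  by rewrite subrr.
exists s', (s \o pres_d P i); split; last by exists s.
by move=> x; rewrite s'E /= subrK.
Qed.

Section Cochains.
Variables (M : lmodType R) (P : proj_resolution M).

Definition cocycle i (phi : P i -> R) := forall x, phi (pres_d P i x) = 0.

Definition coboundary i (phi : P i -> R) :=
  match i return (P i -> R) -> Prop with
  | 0 => fun phi => forall x, phi x = 0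
  | j.+1 => fun phi => exists psi : {linear P j -> R^o},
      forall x, phi x = psi (pres_d P j x)
  end phi.

Lemma coboundaryB i (phi psi : P i -> R) :
  coboundary phi -> coboundary psi -> coboundary (fun x => phi x - psi x).
Proof.
case: i phi psi => [|i] phi psi /=; first by move=> phi0 psi0 x; rewrite phi0 psi0 subrr.
by move=> [f fE] [g gE]; exists (f \- g) => x; rewrite fE gE.
Qed.

Lemma coboundary_ext i (phi psi : P i -> R) :
  phi =1 psi -> coboundary phi -> coboundary psi.
Proof. by move=> /funext ->. Qed.

End Cochains.

Lemma cochain_pullback (M : lmodType R) (P P' : proj_resolution M)
  (f : forall i, {linear P i -> P' i}) :
  (forall i x, pres_d P' i (f i.+1 x) = f i (pres_d P i x)) ->
  forall i (phi : P' i -> R),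
    (cocycle phi -> cocycle (P := P) (phi \o f i)) /\
    (coboundary phi -> coboundary (P := P) (phi \o f i)).
Proof.
move=> fd i phi; split=> [phiP x /=|]; first by rewrite -fd phiP.
case: i phi => [|i] phi /= => [phi0 x|[psi psiE]]; first by rewrite phi0.
by exists (psi \o f i) => x; rewrite /= psiE fd.
Qed.

(** A cocycle kills the summand [d s] of the homotopy formula, and the summand [e] factors through
    the differential. *)
Lemma homotopic_cochain (M : lmodType R) (P : proj_resolution M)
  (w : forall i, {linear P i -> P i}) :
  (forall x, pres_aug P (w 0 x) = pres_aug P x) ->
  (forall i x, pres_d P i (w i.+1 x) = w i (pres_d P i x)) ->
  forall i (phi : {linear P i -> R^o}), cocycle phi ->
    coboundary (P := P) (fun x => phi (w i x) - phi x).
Proof.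
move=> w_aug w_d i phi phiP; have [s [e [sE]]] := chain_homotopy w_aug w_d i.
have wE x : phi (w i x) - phi x = phi (e x).
  by rewrite -linearB sE linearD /= phiP add0r.
case: i phi phiP s e sE wE => [|i] phi phiP s e sE wE /=.
  by move=> e0 x; rewrite wE e0 linear0.
by move=> [t tE]; exists (phi \o t) => x; rewrite wE tE.
Qed.

(** An isomorphism of Ext groups expressed on representatives: two maps in a single degree whose
    pullbacks are mutually inverse up to coboundaries. *)
Lemma Ext_comparison (M : lmodType R) (P P' : proj_resolution M) i :
  exists (f : {linear P i -> P' i}) (g : {linear P' i -> P i}),
  [/\ forall phi : P' i -> R,
        (cocycle phi -> cocycle (P := P) (phi \o f)) /\
        (coboundary phi -> coboundary (P := P) (phi \o f)),
      forall phi : P i -> R,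
        (cocycle phi -> cocycle (P := P') (phi \o g)) /\
        (coboundary phi -> coboundary (P := P') (phi \o g)),
      forall phi : {linear P i -> R^o}, cocycle phi ->
        coboundary (P := P) (fun x => phi (g (f x)) - phi x)
    & forall phi : {linear P' i -> R^o}, cocycle phi ->
        coboundary (P := P') (fun x => phi (f (g x)) - phi x)].
Proof.
have [f [f_aug fd]] := chain_map_exists P P'.
have [g [g_aug gd]] := chain_map_exists P' P.
exists (f i), (g i); split.
- exact: cochain_pullback.
- exact: cochain_pullback.
- by apply: (homotopic_cochain (w := fun i => g i \o f i)) => [x|j x] /=;
    rewrite ?g_aug ?f_aug ?gd ?fd.
- by apply: (homotopic_cochain (w := fun i => f i \o g i)) => [x|j x] /=;
    rewrite ?f_aug ?g_aug ?fd ?gd.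
Qed.

End Comparison.

(** * The left integral *)

Section OneDimensionalExt.

Lemma homology_one_dimensional (k : fieldType) (B : algType k) (X Y Z : lmodType B)
  (f : {linear X -> Y}) (g : {linear Y -> Z}) (chi : B -> k) :
  one_dimensional (homology f g) ->
  (forall b (e : homology f g), b *: e = (chi b)%:A *: e) ->
  exists y, [/\ g y = 0, ~ (exists x, y = f x),
    forall y', g y' = 0 -> exists (c : k) x, y' - c%:A *: y = f x
    & forall b, exists x, b *: y - (chi b)%:A *: y = f x].
Proof.
move=> [e e_neq0 e_gen] e_char.
have classP (v w : kernel g) :
    (quot_class (image_pred_submod f g) v = quot_class (image_pred_submod f g) w) <->
    exists x, (v : Y) - (w : Y) = f x.
  have <- : kernel_val (v - w) = (v : Y) - (w : Y) by exact: (raddfB \val).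
  split=> [/quot_classP vw|vw]; last by apply/quot_classP/asboolP.
  by have /asboolP : `[< exists x, kernel_val (v - w) = f x >] := vw.
have classZ b v : b *: (quot_class (image_pred_submod f g) v : homology f g) =
    quot_class (image_pred_submod f g) (b *: v) by exact: quot_scaleE.
have [y ey] : exists y : kernel g, e = quot_class (image_pred_submod f g) y :=
  quot_class_surj e.
have gy : g (kernel_val y) = 0 by case: (y) => y' /=; rewrite inE => /eqP.
exists (kernel_val y); split=> //.
- move=> [x yx]; apply: e_neq0; rewrite ey -[RHS](scale0r (quot_class _ y : homology f g)).
  by rewrite classZ; apply/classP; exists x; rewrite scale0r subr0.
- move=> y' gy'; have ky' : y' \in kernel_pred g by rewrite inE gy'.
  have [c cE] := e_gen (quot_class (image_pred_submod f g) (Kernel ky')).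
  move: cE; rewrite ey classZ => /classP [x xE].
  by exists c, x; rewrite -xE.
move=> b; have := e_char b e; rewrite ey !classZ => /classP [x xE].
by exists x; rewrite -xE.
Qed.

Variables (k : fieldType) (A : algType k) (eps : {lrmorphism A -> k^o}).
Variables (P : proj_resolution (left_trivial eps)) (d : nat).
Variable chi : {lrmorphism A -> k^o}.

Lemma dual_linear (V : lmodType A) (phi : dual V) :
  exists f : {linear V -> A^o}, forall x, f x = dual_val phi x.
Proof.
case: phi => phi phi_lin /=.
have /asboolP/linear_of_fun [f fE] : `[< linear (phi : V -> A^o) >] := phi_lin.
by exists f.
Qed.

Lemma linear_dual (V : lmodType A) (f : {linear V -> A^o}) :
  exists phi : dual V, forall x, dual_val phi x = f x.
Proof.
have fP : (f : V -> A^c^o) \in @dual_pred A V.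
  exact: (asboolT (linearP f : linear (f : V -> A^o))).
by exists (Dual fP).
Qed.

Lemma integral_cocycle : one_dimensional (Ext P d : lmodType A^c) ->
  left_integral_char P d chi ->
  exists zeta : {linear P d -> A^o}, [/\ cocycle zeta, ~ coboundary zeta,
    forall phi : {linear P d -> A^o}, cocycle phi -> exists c : k,
      coboundary (fun x => (phi x : A) - c *: (zeta x : A))
    & forall a, coboundary (fun x => (zeta x : A) * a - (chi a : k) *: (zeta x : A))].
Proof.
have scaleE (V : lmodType A) (c : k) (phi : dual V) x :
    dual_val ((c%:A : A^c) *: phi) x = c *: (dual_val phi x : A).
  by change ((dual_val phi x : A) * c%:A = c *: (dual_val phi x : A)); rewrite -scalerAr mulr1.
have mulE (V : lmodType A) a (phi : dual V) x :
    dual_val ((a : A^c) *: phi) x = (dual_val phi x : A) * a by [].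
have subE (V : lmodType A) (phi psi : dual V) x :
    dual_val (phi - psi) x = (dual_val phi x : A) - dual_val psi x by [].
have zeroE (V : lmodType A) x : dual_val (0 : dual V) x = 0 by [].
have eq0 (V : lmodType A) (phi : dual V) : (forall x, dual_val phi x = 0) -> phi = 0.
  by move=> phi0; apply: val_inj; apply/funext => x; rewrite [LHS]phi0.
have dualE (V W : lmodType A) (f : {linear V -> W}) phi x :
   dual_val (dual_map f phi) x = dual_val phi (f x) by [].
have dual_coc i (phi : dual (P i)) : dual_map (pres_d P i) phi = 0 <-> cocycle (dual_val phi : P i -> A).
  split=> [phi0 x|phi0]; first by rewrite -dualE phi0.
  by apply: eq0 => x; rewrite dualE phi0.
(* [Ext] is defined by cases on the degree; the argument is made once for an arbitrary incoming map
   [f] whose image is the coboundaries. *)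
have unpack i (X : lmodType A^c) (f : {linear X -> dual (P i)}) :
    (forall phi : dual (P i), (exists x, phi = f x) <->
      coboundary (P := P) (dual_val phi : P i -> A)) ->
    one_dimensional (homology f (dual_map (pres_d P i)) : lmodType A^c) ->
    (forall (a : A) (e : homology f (dual_map (pres_d P i))),
       (a : A^c) *: e = ((chi a : k)%:A : A^c) *: e) ->
    exists zeta : {linear P i -> A^o}, [/\ cocycle zeta, ~ coboundary zeta,
      forall phi : {linear P i -> A^o}, cocycle phi -> exists c : k,
        coboundary (fun x => (phi x : A) - c *: (zeta x : A))
      & forall a, coboundary (fun x => (zeta x : A) * a - (chi a : k) *: (zeta x : A))].
  move=> fP one_dim char.
  have [zeta [zeta_coc zeta_cob zeta_gen zeta_char]] :=
    homology_one_dimensional (chi := fun a : A^c => chi a : k) one_dim char.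
  have [z zE] := dual_linear zeta; exists z; split.
  - by move=> x; rewrite zE; have /dual_coc := zeta_coc; apply.
  - move=> z_cob; apply/zeta_cob/fP.
    by have -> : (dual_val zeta : P i -> A) = z by apply/funext => x; rewrite zE.
  - move=> phi phi_coc; have [psi psiE] := linear_dual phi.
    have [|c cE] := zeta_gen psi.
      by apply/dual_coc => x; rewrite psiE; apply: phi_coc.
    exists c; have /fP := cE; congr (coboundary _); apply/funext => x.
    by rewrite subE psiE scaleE zE.
  move=> a; have /fP := zeta_char a; congr (coboundary _); apply/funext => x.
  by rewrite subE scaleE mulE zE.
case: d => [|i]; apply: unpack => phi /=; split.
- by move=> [x ->] y.
- by move=> phi0; exists 0; apply: eq0.
- move=> [psi ->]; have [f fE] := dual_linear psi.
  by exists f => x; rewrite dualE fE.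
move=> [f fE]; have [psi psiE] := linear_dual f.
exists psi; apply: val_inj; apply/funext => x.
by rewrite [LHS]fE -psiE.
Qed.

End OneDimensionalExt.
Lemma mx_subE (V : zmodType) m n (M N : 'M[V]_(m, n)) i j : (M - N) i j = M i j - N i j.
Proof. by rewrite !mxE. Qed.

(** * Cochains on a free resolution as column vectors *)

Section FreeCochains.
Variables (R : nzRingType) (L : R -> Prop) (F : free_resolution L).
Local Notation size := (resolution_size (fres_tail F)).

(** In degree 0 the incoming differential is a matrix without columns, so its image is zero and
    coboundaries are the image of one matrix in every degree. *)
Definition fres_prev i : {p : nat & 'M[R]_(size i, p)} :=
  match i return {p : nat & 'M[R]_(size i, p)} with
  | 0 => existT (fun p => 'M[R]_(1, p)) 0%N (const_mx 0)
  | j.+1 => existT _ (size j) (fres_d F j)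
  end.

Lemma fres_ddE i : fres_d F i.+1 *m fres_d F i = 0.
Proof.
apply/row_matrixP => j; rewrite row0 row_mul; apply/fres_exact.
by exists (delta_mx 0 j); rewrite rowE.
Qed.

Variables (M : lmodType R) (aug : {linear 'rV[R]_1 -> M}).
Hypothesis aug_surj : forall y, exists x, aug x = y.
Hypothesis aug_ker : forall x, aug x = 0 <-> L (x 0 0).
Local Notation P := (free_proj_resolution F aug_surj aug_ker).

Lemma free_cocycle i (v : 'cV[R]_(size i)) :
  cocycle (P := P) (i := i) (fun x : 'rV_(size i) => (x *m v) 0 0) <-> fres_d F i *m v = 0.
Proof.
split=> [v_coc|Dv x]; last by rewrite /= -mulmxA Dv mulmx0 mxE.
by apply: col_ext => x; rewrite mulmxA mulmx0 [RHS]mxE; apply: v_coc.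
Qed.

Lemma free_coboundary i (v : 'cV[R]_(size i)) :
  coboundary (P := P) (i := i) (fun x : 'rV_(size i) => (x *m v) 0 0) <->
  exists w, v = projT2 (fres_prev i) *m w.
Proof.
case: i v => [|i] v /=; split.
- move=> v0; exists 0; apply: col_ext => x; rewrite mulmx0 mulmx0 [RHS]mxE; exact: v0.
- by move=> [w ->] x; rewrite mul0mx mulmx0 mxE.
- move=> [psi psiE]; have [w wE] := row_linearE psi; exists w.
  by apply: col_ext => x; rewrite psiE wE mulmxA.
move=> [w ->]; have [psi psiE] := col_linear w; exists psi => x.
by rewrite psiE mulmxA.
Qed.

End FreeCochains.

(** A column representing the left integral: it spans the top cohomology of the dual complex over
    [k], and right multiplication by [a] acts on its class through [chi]. *)
Record integral_column_spec (k : fieldType) (A : algType k) (L : A -> Prop)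
  (F : free_resolution L) (chi : A -> k) d
  (z : 'cV[A]_(resolution_size (fres_tail F) d)) : Prop := IntegralColumn {
  intcol_cocycle : fres_d F d *m z = 0;
  intcol_nontrivial : ~ (exists w, z = projT2 (fres_prev F d) *m w);
  intcol_generates : forall v, fres_d F d *m v = 0 -> exists (c : k) w,
    v = z *m (c%:A)%:M + projT2 (fres_prev F d) *m w;
  intcol_char : forall a, exists w,
    z *m a%:M = z *m ((chi a)%:A)%:M + projT2 (fres_prev F d) *m w
}.

(** The cocycle [zeta] on the given resolution [P] is pulled back along the comparison map [g] to
    the free resolution; [z] holds its values on the basis. *)
Lemma integral_column (k : fieldType) (A : algType k) (eps chi : {lrmorphism A -> k^o})
  (P : proj_resolution (left_trivial eps)) d
  (F : free_resolution (fun a : A => (eps a : k) = 0)) :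
  one_dimensional (Ext P d : lmodType A^c) -> left_integral_char P d chi ->
  exists z : 'cV[A]_(resolution_size (fres_tail F) d),
    integral_column_spec (fun a => chi a : k) z.
Proof.
move=> one_dim char.
have [|aug augE] := @linear_of_fun A 'rV[A]_1 (left_trivial eps) (fun x => (eps (x 0 0) : k)).
  by move=> a x y; rewrite !mxE rmorphD rmorphM.
have aug_surj y : exists x, aug x = y.
  exists ((y : k)%:A)%:M; rewrite augE mxE eqxx mulr1n linearZ /= rmorph1.
  exact: mulr1.
have aug_ker x : aug x = 0 <-> (eps (x 0 0) : k) = 0 by rewrite augE.
pose P' := free_proj_resolution F aug_surj aug_ker.
have [f [g [f_pull g_pull gf_hom fg_hom]]] := Ext_comparison P P' d.
have [zeta [zeta_coc zeta_ncob zeta_gen zeta_char]] := integral_cocycle one_dim char.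
have [z zE] := row_linearE (zeta \o g : {linear 'rV_(resolution_size (fres_tail F) d) -> A^o}).
have colE (v : 'cV[A]_(resolution_size (fres_tail F) d)) a (x : 'rV_(resolution_size (fres_tail F) d)) :
    (x *m (v *m a%:M)) 0 0 = (x *m v) 0 0 * a.
  by rewrite mulmxA mxE big_ord1 !mxE eqxx mulr1n.
have subE (v w : 'cV[A]_(resolution_size (fres_tail F) d)) (x : 'rV_(resolution_size (fres_tail F) d)) :
    (x *m (v - w)) 0 0 = (x *m v) 0 0 - (x *m w) 0 0.
  by rewrite mulmxBr !mxE.
have scaleE (a : A) (c : k) : a * c%:A = c *: a by rewrite -scalerAr mulr1.
have cobE (v w : 'cV[A]_(resolution_size (fres_tail F) d)) :
    coboundary (P := P') (i := d) (fun x : 'rV_(resolution_size (fres_tail F) d) =>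
      (x *m v) 0 0 - (x *m w) 0 0) ->
    exists u, v = w + projT2 (fres_prev F d) *m u.
  move=> vw; have [|u uE] := (free_coboundary aug_surj aug_ker (v - w)).1.
    by apply: coboundary_ext vw => x; rewrite subE.
  by exists u; rewrite -uE addrC subrK.
exists z; split.
- apply/(free_cocycle aug_surj aug_ker) => x; rewrite -[LHS]zE.
  exact: (g_pull _).1.
(* If [zeta g] were a coboundary, so would be [zeta g f], which differs from [zeta] by a
   coboundary. *)
- move=> /(free_coboundary aug_surj aug_ker) z_cob; apply: zeta_ncob.
  have zg_cob := (f_pull _).2 z_cob.
  have := coboundaryB zg_cob (gf_hom _ zeta_coc).
  apply: coboundary_ext => x /=; rewrite -zE /=.
  by rewrite opprB addrC subrK.
- move=> v /(free_cocycle aug_surj aug_ker) v_coc.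
  have [phi phiE] := col_linear v.
  have phi_coc : cocycle (P := P') (i := d) phi by move=> x; rewrite phiE; apply: v_coc.
  have [c c_cob] := zeta_gen (phi \o f) ((f_pull _).1 phi_coc).
  exists c; apply: cobE.
  have := coboundaryB ((g_pull _).2 c_cob) (fg_hom _ phi_coc).
  apply: coboundary_ext => x /=; rewrite colE scaleE -zE -phiE /=.
  by rewrite opprB addrC subrKA.
move=> a; apply: cobE; have := (g_pull _).2 (zeta_char a).
by apply: coboundary_ext => x /=; rewrite !colE scaleE -zE.
Qed.

Section MatrixComparison.
Variables (R : nzRingType) (L : R -> Prop).
Hypothesis L_sub : submodule (L : R^o -> Prop).

(** The comparison map from [F1] to [F2] multiplies rows by [U] on the right; dually [U] multiplies
    columns on the left and leads from cochains of [F2] to those of [F1]. Both resolve the same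
    quotient [R/L]. *)
Lemma free_resolution_comparison (F1 F2 : free_resolution L) i :
  exists (U : 'M[R]_(resolution_size (fres_tail F1) i, resolution_size (fres_tail F2) i))
         (V : 'M[R]_(resolution_size (fres_tail F2) i, resolution_size (fres_tail F1) i)),
  [/\ forall v : 'cV[R]_ _, fres_d F2 i *m v = 0 -> fres_d F1 i *m (U *m v) = 0,
      forall v : 'cV[R]_ _, fres_d F1 i *m v = 0 -> fres_d F2 i *m (V *m v) = 0
    & [/\ forall w : 'cV[R]_ _, exists w', U *m (projT2 (fres_prev F2 i) *m w) = projT2 (fres_prev F1 i) *m w',
      forall w : 'cV[R]_ _, exists w', V *m (projT2 (fres_prev F1 i) *m w) = projT2 (fres_prev F2 i) *m w',
      forall v : 'cV[R]_ _, fres_d F1 i *m v = 0 -> exists w,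
        U *m (V *m v) = v + projT2 (fres_prev F1 i) *m w
    & forall v : 'cV[R]_ _, fres_d F2 i *m v = 0 -> exists w,
        V *m (U *m v) = v + projT2 (fres_prev F2 i) *m w]].
Proof.
have L_closed : submod_closed ([pred x | `[< L x >]] : {pred R^o}).
  split=> [|a x y Lx Ly]; apply: asboolT; first exact: L_sub.1.
  by apply: L_sub.2; [apply: (asboolW Lx)|apply: (asboolW Ly)].
pose M : lmodType R := quot_module L_closed.
have [|aug augE] := @linear_of_fun R 'rV[R]_1 M (fun x => quot_class L_closed (x 0 0)).
  move=> a x y; rewrite !mxE quot_classD; congr (_ + _); exact/esym/quot_scaleE.
have aug_surj y : exists x, aug x = y.
  have [x ->] := quot_class_surj y; exists x%:M.
  by rewrite augE mxE eqxx mulr1n.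
have class0 : quot_class L_closed 0 = 0.
  by have := @quot_scaleE R R^o _ L_closed 0 0; rewrite scaler0 => <-; apply: scale0r.
have aug_ker x : aug x = 0 <-> L (x 0 0).
  rewrite augE -class0; split=> [/quot_classP|Lx].
    by rewrite subr0 => /asboolW.
  by apply/quot_classP; rewrite subr0; apply: asboolT.
have [f [g [f_pull g_pull gf_hom fg_hom]]] :=
  Ext_comparison (free_proj_resolution F1 aug_surj aug_ker)
    (free_proj_resolution F2 aug_surj aug_ker) i.
have [U UE] := row_linear_mx (f : {linear 'rV_(resolution_size (fres_tail F1) i) ->
   'rV_(resolution_size (fres_tail F2) i)}).
have [V VE] := row_linear_mx (g : {linear 'rV_(resolution_size (fres_tail F2) i) ->
   'rV_(resolution_size (fres_tail F1) i)}).
have coc1 := free_cocycle (F := F1) aug_surj aug_ker (i := i).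
have coc2 := free_cocycle (F := F2) aug_surj aug_ker (i := i).
have cob1 := free_coboundary (F := F1) aug_surj aug_ker (i := i).
have cob2 := free_coboundary (F := F2) aug_surj aug_ker (i := i).
exists U, V; split; last split.
- move=> v /coc2 /(f_pull _).1 v_coc; apply/coc1 => x; have := v_coc x.
  by rewrite /= UE !mulmxA.
- move=> v /coc1 /(g_pull _).1 v_coc; apply/coc2 => x; have := v_coc x.
  by rewrite /= VE !mulmxA.
- move=> w; apply/cob1; have /cob2/(f_pull _).2 : exists w', projT2 (fres_prev F2 i) *m w =
    projT2 (fres_prev F2 i) *m w' by exists w.
  by apply: coboundary_ext => x /=; rewrite UE !mulmxA.
- move=> w; apply/cob2; have /cob1/(g_pull _).2 : exists w', projT2 (fres_prev F1 i) *m w =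
    projT2 (fres_prev F1 i) *m w' by exists w.
  by apply: coboundary_ext => x /=; rewrite VE !mulmxA.
- move=> v /coc1 v_coc; have [phi phiE] := col_linear v.
  have phi_coc : cocycle (P := free_proj_resolution F1 aug_surj aug_ker) (i := i) phi.
    by move=> x; rewrite phiE; apply: v_coc.
  have [|w wE] := (cob1 (U *m (V *m v) - v)).1.
    apply: coboundary_ext (gf_hom _ phi_coc) => x /=.
    by rewrite !phiE UE VE mulmxBr mx_subE !mulmxA.
  by exists w; rewrite -wE addrC subrK.
move=> v /coc2 v_coc; have [phi phiE] := col_linear v.
have phi_coc : cocycle (P := free_proj_resolution F2 aug_surj aug_ker) (i := i) phi.
  by move=> x; rewrite phiE; apply: v_coc.
have [|w wE] := (cob2 (V *m (U *m v) - v)).1.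
  apply: coboundary_ext (fg_hom _ phi_coc) => x /=.
  by rewrite !phiE UE VE mulmxBr mx_subE !mulmxA.
by exists w; rewrite -wE addrC subrK.
Qed.

End MatrixComparison.

(** * Resolutions over the enveloping algebra *)

Lemma kmod_linear (k : fieldType) (A : algType k) (V W : lmodType A) (f : {linear V -> W}) :
  exists g : {linear kmod V -> kmod W}, g =1 f.
Proof. by apply: linear_of_fun => c x y; apply: (linearP f). Qed.

Lemma kmod_mulmx_linear (k : fieldType) (A : algType k) m n p (D : 'M[A]_(m, n)) :
  exists g : {linear kmod ('M[A]_(n, p) : lmodType A) -> kmod ('M[A]_(m, p) : lmodType A)},
    forall x, g x = D *m x.
Proof.
have [|g gE] := @linear_of_fun k (kmod ('M[A]_(n, p) : lmodType A))
  (kmod ('M[A]_(m, p) : lmodType A)) (fun x => D *m x); last by exists g.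
move=> c x y; apply/matrixP => i j; rewrite [RHS]kmod_mx_linE !mxE scaler_sumr -big_split.
by apply: eq_bigr => l _; rewrite kmod_mx_linE mulrDr -scalerAr.
Qed.

Section SigmaLinear.
Variables (k : fieldType) (A : algType k).

Fact sigma_linear : linear (@sigma k A).
Proof. exact: (tensor_bilinear A).2. Qed.

HB.instance Definition _ :=
  GRing.isLinear.Build k A (enveloping A) *:%R (@sigma k A) sigma_linear.

End SigmaLinear.

Section EnvelopingTransport.
Variables (k : fieldType) (A : algType k) (H : hopf_algebra A).
Local Notation T := (enveloping A).
Local Notation rho := (rho H).
Local Notation eps a := (counit H a : k).
Local Notation S := (antipode H).
Local Notation kMA p q := (kmod ('M[A]_(p, q) : lmodType A)).
Local Notation kMT p q := (kmod ('M[T]_(p, q) : lmodType T)).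

Variable mu : {linear T -> A}.
Hypothesis muE : forall x y, mu (tensor x y) = x * y.

Lemma mu_sigma b : mu (sigma b) = b.
Proof. by rewrite muE mul1r. Qed.

(** With [rho a] as the right factor, multiplication by [rho(D)] touches only the first tensor
    factor: it is [D] tensored with the identity. *)
Lemma mulmx_tensor_row p q r (M : 'M[A]_(p, q)) (D : 'M[A]_(q, r)) b :
  tensor_mx (fun a b => sigma b * rho a) M b *m map_mx rho D =
  tensor_mx (fun a b => sigma b * rho a) (M *m D) b.
Proof.
apply/matrixP => i j; rewrite !mxE rmorph_sum mulr_sumr.
by apply: eq_bigr => l _; rewrite !mxE rmorphM mulrA.
Qed.

Lemma mulmx_tensor_col p q r (M : 'M[A]_(q, r)) (D : 'M[A]_(p, q)) b :
  map_mx rho D *m tensor_mx (fun a b => rho a * sigma b) M b =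
  tensor_mx (fun a b => rho a * sigma b) (D *m M) b.
Proof.
apply/matrixP => i j; rewrite !mxE rmorph_sum mulr_suml.
by apply: eq_bigr => l _; rewrite !mxE rmorphM mulrA.
Qed.

Lemma tensor_colE p (z : 'cV[A]_p) b :
  tensor_mx (fun a b => rho a * sigma b) z b = map_mx rho z *m (sigma b)%:M.
Proof. by apply/colP => i; rewrite !mxE big_ord1 !mxE eqxx mulr1n. Qed.

Section Resolution.
Variable F : free_resolution (fun a : A => eps a = 0).

Fact enveloping_exact0 (x : 'rV[T]_1) :
  mu (x 0 0) = 0 <-> exists y, x = y *m map_mx rho (fres_d F 0).
Proof.
split=> [mux|[y ->]]; last first.
  rewrite mxE linear_sum big1 // => i _; rewrite mxE (mu_rho H muE).
  suff -> : eps (fres_d F 0 i 0) = 0 by rewrite scale0r.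
  have := @fres_exact0 _ _ F (row i (fres_d F 0)); rewrite mxE => ->.
  by exists (delta_mx 0 i); rewrite rowE.
have [f fE] := kmod_linear (mulmxr (fres_d F 0) : {linear 'M[A]_(1, _) -> 'M[A]_(1, 1)}).
have [G GE] := kmod_linear (mulmxr (map_mx rho (fres_d F 0)) : {linear 'M[T]_(1, _) -> 'M[T]_(1, 1)}).
(* The counit is made an endomorphism by embedding [k] in [A] as scalars. Its extension is [sigma]
   after [mu], since [mu (sigma b * rho a) = eps(a) b]. *)
have [|g gE] := @linear_of_fun k (kMA 1 1) (kMA 1 1) (fun x => ((eps (x 0 0))%:A)%:M).
  move=> c u v; apply/matrixP => i j; rewrite [RHS]kmod_mx_linE kmod_mx_linE !mxE.
  by rewrite !ord1 eqxx !mulr1n linearP scalerDl scalerA.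
have [|K KE] := @linear_of_fun k (kMT 1 1) (kMT 1 1) (fun x => (sigma (mu (x 0 0)))%:M).
  move=> c u v; apply/matrixP => i j; rewrite [RHS]kmod_mx_linE kmod_mx_linE !mxE.
  by rewrite !ord1 eqxx !mulr1n !linearP.
have [||||y yE] := tensor_mx_exact (sigma_rho_tensor_product H) (f := f) (g := g)
    (F := G) (G := K) _ _ _ (y := x).
- by move=> M b; rewrite fE GE /= mulmx_tensor_row.
- move=> M b; rewrite KE gE; apply/matrixP => i j; rewrite !mxE !ord1 eqxx !mulr1n.
  rewrite (mu_rho H muE) mu_sigma !linearZ /=.
  by rewrite rmorph1 -scalerAr mulr1.
- move=> y; rewrite gE => /matrixP/(_ 0 0); rewrite !mxE eqxx mulr1n => epsy.
  have [|w wE] := (@fres_exact0 _ _ F y).1; last by exists w; rewrite fE.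
  have := congr1 (fun a => eps a) epsy.
  by rewrite /= linearZ rmorph1 linear0 => <-; apply/esym/mulr1.
- by rewrite KE mux; apply/matrixP => i j; rewrite !mxE linear0 mul0rn.
by exists y; rewrite yE GE.
Qed.

Fact enveloping_exact i (x : 'rV[T]_(fres_tail F i)) :
  x *m map_mx rho (fres_d F i) = 0 <-> exists y, x = y *m map_mx rho (fres_d F i.+1).
Proof.
split=> [xD|[y ->]]; last by rewrite -mulmxA -map_mxM fres_ddE map_mx0 mulmx0.
have [f fE] := kmod_linear (mulmxr (fres_d F i.+1) : {linear 'rV[A]_ _ -> 'rV[A]_ _}).
have [G GE] := kmod_linear (mulmxr (map_mx rho (fres_d F i.+1)) : {linear 'rV[T]_ _ -> 'rV[T]_ _}).
have [g gE] := kmod_linear (mulmxr (fres_d F i) : {linear 'rV[A]_ _ -> 'rV[A]_ _}).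
have [K KE] := kmod_linear (mulmxr (map_mx rho (fres_d F i)) : {linear 'rV[T]_ _ -> 'rV[T]_ _}).
have [||||y yE] := tensor_mx_exact (sigma_rho_tensor_product H) (f := f) (g := g)
    (F := G) (G := K) _ _ _ (y := x).
- by move=> M b; rewrite fE GE /= mulmx_tensor_row.
- by move=> M b; rewrite gE KE /= mulmx_tensor_row.
- move=> y; rewrite gE => /fres_exact [w ->]; by exists w; rewrite fE.
- by rewrite KE.
by exists y; rewrite yE GE.
Qed.

Definition enveloping_resolution : free_resolution (fun t : T => mu t = 0) :=
  FreeResolution (fres_d := fun i => map_mx rho (fres_d F i) :
      'M_(fres_tail F i, resolution_size (fres_tail F) i))
    enveloping_exact0 enveloping_exact.

Lemma enveloping_prev i (t : 'cV_ _) :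
  (exists w, t = projT2 (fres_prev enveloping_resolution i) *m w) <->
  (exists w, t = map_mx rho (projT2 (fres_prev F i)) *m w).
Proof.
case: i t => [|i] t //=.
have E0 (M N : 'M[T]_(1, 0)) : M = N by apply/matrixP => ? [].
by rewrite (E0 (const_mx 0) (map_mx rho (const_mx 0))).
Qed.

End Resolution.

Section Columns.
Variables (p q r : nat) (E : 'M[A]_(q, p)) (D : 'M[A]_(r, q)) (z : 'cV[A]_q).
Hypotheses (Dz : D *m z = 0) (zE : ~ (exists w, z = E *m w)).
Hypothesis z_gen : forall v, D *m v = 0 ->
  exists (c : k) w, v = z *m (c%:A)%:M + E *m w.

Lemma mul_col_scalar (c : k) (v : 'cV[A]_q) : v *m (c%:A)%:M = (c%:A : A) *: v.
Proof.
by apply/colP => i; rewrite !mxE big_ord1 !mxE eqxx mulr1n -scalerAr -scalerAl mulr1 mul1r.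
Qed.

(** A [k]-linear coordinate along [z] modulo the image of [E]; it exists because [z] is not in that
    image. *)
Lemma column_functional : exists lam : {linear kMA q 1 -> k^o},
  lam z = 1 /\ forall w, lam (E *m w) = 0.
Proof.
have [g gE] := kmod_mulmx_linear 1 E.
(* The value [f (c, w) = c z + E w] determines [c], so the first component of a pseudo-inverse of
   [f] is the functional sought. *)
have [|f fE] := @linear_of_fun k (k^o * kMA p 1)%type (kMA q 1)
    (fun cw => g cw.2 + kmod_scale (cw.1 : k) (z : kMA q 1)).
  move=> c [a u] [b v] /=; rewrite linearP scalerDr.
  rewrite kmod_scaleDl -kmod_scaleA; exact: addrACA.
have [f' f'P] := linear_pseudo_inverse f.
have zcancel (c : k) w w' : E *m w + (c%:A : A) *: z = E *m w' -> c = 0.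
  move=> Ew; apply/eqP/negP => /negP c0; apply: zE.
  exists ((w' - w) *m (c^-1%:A)%:M); rewrite mulmxA mulmxBr -Ew addrC addKr.
  by rewrite mul_col_scalar scalerA -scalerAl mul1r scalerA mulVf // !scale1r.
have [|lam lamE] := @linear_of_fun k (kMA q 1) k^o (fun y => (f' y).1).
  by move=> c x y; rewrite linearP.
exists lam; rewrite lamE; split=> [|w].
  apply/eqP; rewrite -subr_eq0; apply/eqP.
  have := f'P (1, 0); rewrite !fE linear0 add0r kmod_scale1 gE => zfix.
  apply: (zcancel _ (f' z).2 0); rewrite mulmx0 [_%:A]scalerBl !scale1r scalerBl scale1r.
  by apply/eqP; rewrite addrA subr_eq0; apply/eqP.
have z0 : kmod_scale 0 (z : kMA q 1) = 0 by rewrite /kmod_scale !scale0r.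
rewrite lamE; have := f'P (0, w); rewrite !fE /= z0 addr0 !gE => wfix.
exact: zcancel wfix.
Qed.

(** The extension [Lam] of [lam] recovers [b] from [rho(z) (1 (x) b)] and kills the image of
    [rho(E)], which gives uniqueness. For existence, a column killed by both [D] and [lam] is in the
    image of [E]; this exactness is transported and applied to [t] minus its component along
    [rho(z)]. *)
Lemma enveloping_columns :
  (forall b w, map_mx rho z *m (sigma b)%:M = map_mx rho E *m w -> b = 0) /\
  (forall t, map_mx rho D *m t = 0 -> exists b w,
    t = map_mx rho z *m (sigma b)%:M + map_mx rho E *m w).
Proof.
have [lam [lam_z lam_E]] := column_functional.
have tauP := rho_sigma_tensor_product H.
have [|l lE] := @linear_of_fun k (kMA q 1) (kMA 1 1) (fun y => ((lam y : k)%:A)%:M).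
  move=> c u v; apply/matrixP => i j; rewrite [RHS]kmod_mx_linE !mxE.
  by rewrite !ord1 eqxx !mulr1n linearP scalerDl scalerA.
have [Lam LamE] := tensor_mx_extend tauP l.
have Lam_tensor M b : Lam (tensor_mx (fun a b => rho a * sigma b) M b) =
    (sigma ((lam M : k) *: b))%:M.
  rewrite LamE lE; apply/matrixP => i j; rewrite !mxE !ord1 eqxx !mulr1n.
  by rewrite !linearZ /= rmorph1 -scalerAl mul1r.
(* All values of [Lam] lie in [sigma(A)], and [mu] reads off the element of [A]. *)
have Lam_sigma t : Lam t = (sigma (mu ((Lam t : 'M[T]_1) 0 0)))%:M.
  apply: (tensor_mx_ext tauP (F := fun t : 'M[T]_(q, 1) => Lam t : 'M[T]_1)
    (G := fun t => (sigma (mu ((Lam t : 'M[T]_1) 0 0)))%:M)) => [M N|M N|M b].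
  - exact: linearD.
  - by rewrite [Lam _]linearD [X in mu X]mxE !raddfD.
  by rewrite Lam_tensor mxE eqxx mulr1n mu_sigma.
have Lam_E w : Lam (map_mx rho E *m w) = 0.
  apply: (tensor_mx_ext tauP (F := fun w => Lam (map_mx rho E *m w) : 'M[T]_1)
    (G := fun=> 0)) => [M N|M N|M b].
  - by rewrite mulmxDr; apply: linearD.
  - by rewrite addr0.
  by rewrite mulmx_tensor_col Lam_tensor lam_E scale0r linear0 raddf0.
have Lam_z b : Lam (map_mx rho z *m (sigma b)%:M) = (sigma b)%:M.
  by rewrite -tensor_colE Lam_tensor lam_z scale1r.
split=> [b w zb|t Dt].
  have := Lam_E w; rewrite -zb Lam_z => /matrixP/(_ 0 0); rewrite !mxE eqxx mulr1n.
  by move=> /(congr1 mu); rewrite mu_sigma linear0.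
pose b := mu ((Lam t : 'M[T]_1) 0 0); exists b.
have [f fE] := kmod_mulmx_linear 1 E.
have [G GE] := kmod_mulmx_linear 1 (map_mx rho E).
have [D' D'E] := kmod_mulmx_linear 1 D.
have [D2 D2E] := kmod_mulmx_linear 1 (map_mx rho D).
(* Stacking [D] and [lam] into one map with [r + 1] rows turns the two conditions into a single
   kernel, as [tensor_mx_exact] expects. *)
have col_lin (B : algType k) (V : lmodType k) (h1 : {linear V -> kmod ('M[B]_(r, 1) : lmodType B)})
   (h2 : {linear V -> kmod ('M[B]_(1, 1) : lmodType B)}) :
   exists h : {linear V -> kmod ('M[B]_(r + 1, 1) : lmodType B)}, forall v,
     h v = col_mx (h1 v) (h2 v).
  have [|h hE] := @linear_of_fun k V (kmod ('M[B]_(r + 1, 1) : lmodType B))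
    (fun v => col_mx (h1 v) (h2 v)); last by exists h.
  move=> c u v; apply/matrixP => i j; rewrite [RHS]kmod_mx_linE !mxE !linearP.
  by case: (fintype.split i) => i'; rewrite kmod_mx_linE.
have [g gE] := col_lin A _ D' l.
have [K KE] := col_lin T _ D2 Lam.
have [||||w wE] := tensor_mx_exact tauP (f := f) (g := g) (F := G) (G := K) _ _ _
    (y := t - map_mx rho z *m (sigma b)%:M).
- by move=> M c; rewrite fE GE mulmx_tensor_col.
- move=> M c; rewrite gE KE D2E mulmx_tensor_col LamE D'E.
  apply/matrixP => i j; rewrite !mxE.
  by case: (fintype.split i) => i'; rewrite !mxE.
- move=> y; rewrite gE D'E lE -[0]vsubmxK => /eq_col_mx [].
  rewrite !linear0 => /z_gen [c [w ->]] lam0; exists w; rewrite fE.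
  suff -> : c = 0 by rewrite mul_col_scalar !scale0r add0r.
  move: lam0 => /matrixP/(_ 0 0); rewrite !mxE eqxx mulr1n => /(congr1 (fun a => eps a)).
  rewrite /= linear0 linearZ /= rmorph1 => lam0.
  have : lam (z *m (c%:A)%:M + E *m w) = 0 by rewrite -lam0; apply/esym/mulr1.
  rewrite linearD lam_E addr0 mul_col_scalar linearZ lam_z.
  by move=> <-; apply/esym/mulr1.
- rewrite KE D2E; apply/matrixP => i j; rewrite !mxE; case: (fintype.split i) => i'.
    by rewrite mulmxBr Dt mulmxA -map_mxM Dz map_mx0 mul0mx subrr mxE.
  by rewrite linearB /= Lam_z -Lam_sigma subrr mxE.
by exists w; move: wE; rewrite GE => <-; rewrite addrC subrK.
Qed.

Variable chi : {lrmorphism A -> k^o}.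
Hypothesis z_char : forall a, exists w,
  z *m a%:M = z *m ((chi a : k)%:A)%:M + E *m w.

(** In the expansion of [x (x) 1], each [z x_1] is [chi(x_1) z] up to a correction [E w(x_1)]. The
    scalars gather into the winding and the corrections into the witness. *)
Lemma enveloping_twist x : exists w, map_mx rho z *m (tensor x 1)%:M =
  map_mx rho z *m (sigma (S (S (left_winding H chi x))))%:M + map_mx rho E *m w.
Proof.
have /choice [w wE] := z_char.
exists (\sum_(s <- comul H x) map_mx rho (w s.1) *m (sigma (S (S s.2)))%:M).
have -> : sigma (S (S (left_winding H chi x))) =
    \sum_(s <- comul H x) (chi s.1 : k) *: sigma (S (S s.2)).
  by rewrite /left_winding !linear_sum; apply: eq_bigr => s _; rewrite !linearZ.
rewrite (tensor_rho_sigma H) !(raddf_sum (scalar_mx (n := 1))) !mulmx_sumr -big_split.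
apply: eq_bigr => s _ /=.
rewrite mul1r scalar_mxM mulmxA -map_scalar_mx -map_mxM wE map_mxD mulmxDl !map_mxM mulmxA.
congr (_ + _); rewrite -mulmxA; congr (_ *m _); rewrite map_scalar_mx -scalar_mxM.
by rewrite /= linearZ /= rmorph1 -scalerAl mul1r.
Qed.

End Columns.
End EnvelopingTransport.

(** * Comparison of the two twists *)

Section Congruence.
Variables (R : nzRingType) (p q : nat) (E : 'M[R]_(q, p)).

Definition col_cong (t t' : 'cV[R]_q) := exists w, t = t' + E *m w.

Lemma col_cong_trans t2 t1 t3 : col_cong t1 t2 -> col_cong t2 t3 -> col_cong t1 t3.
Proof. by move=> [w ->] [w' ->]; exists (w' + w); rewrite mulmxDr addrA. Qed.

Lemma col_cong_sym t t' : col_cong t t' -> col_cong t' t.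
Proof. by move=> [w ->]; exists (- w); rewrite mulmxN addrK. Qed.

Lemma col_cong_mulr t t' (s : 'M[R]_1) : col_cong t t' -> col_cong (t *m s) (t' *m s).
Proof. by move=> [w ->]; exists (w *m s); rewrite mulmxDl mulmxA. Qed.

End Congruence.

Lemma counit_ker_submodule (k : fieldType) (A : algType k) (H : hopf_algebra A) :
  submodule (fun a : A^o => (counit H a : k) = 0).
Proof.
split=> [|a x y epsx epsy]; first exact: linear0.
have -> : (counit H (a *: x + y) : k) = (counit H a : k) * counit H x + counit H y.
  by rewrite -rmorphM -rmorphD.
by rewrite epsx epsy mulr0 addr0.
Qed.

(* Both resolutions rho(F1) and rho(F2) resolve the bimodule A = R / ker mu, and u is
   the coefficient of the class of rho(z1) in the image of that of rho(z2) under the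
   comparison map. *)
Lemma twists_conjugate (k : fieldType) (A : algType k) (H1 H2 : hopf_algebra A)
  (chi : {lrmorphism A -> k^o}) d
  (F1 : free_resolution (fun a : A => (counit H1 a : k) = 0))
  (F2 : free_resolution (fun a : A => (counit H2 a : k) = 0))
  (z1 : 'cV[A]_(resolution_size (fres_tail F1) d))
  (z2 : 'cV[A]_(resolution_size (fres_tail F2) d)) :
  integral_column_spec (fun a => chi a : k) z1 -> integral_column_spec (fun a => chi a : k) z2 ->
  exists u v : A, [/\ u * v = 1, v * u = 1 & forall x,
    antipode H2 (antipode H2 (left_winding H2 chi x)) * u =
    u * antipode H1 (antipode H1 (left_winding H1 chi x))].
Proof.
move=> [Dz1 zE1 gen1 char1] [Dz2 zE2 gen2 char2].
have [mu muE] := mu_exists A.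
pose G1 := enveloping_resolution muE F1; pose G2 := enveloping_resolution muE F2.
pose E1 := map_mx (rho H1) (projT2 (fres_prev F1 d)).
pose E2 := map_mx (rho H2) (projT2 (fres_prev F2 d)).
pose y1 := map_mx (rho H1) z1; pose y2 := map_mx (rho H2) z2.
have [|U [V [Ucoc Vcoc [Ucob Vcob UV VU]]]] := @free_resolution_comparison _ _ _ G1 G2 d.
  split=> [|a x y mux muy]; first exact: linear0.
  rewrite linearD muy addr0; exact: mu_ker_lmul.
have [inj1 ker1] := enveloping_columns H1 muE Dz1 zE1 gen1.
have [inj2 ker2] := enveloping_columns H2 muE Dz2 zE2 gen2.
have prev1 (t : 'cV_ _) : (exists w, t = projT2 (fres_prev G1 d) *m w) <-> (exists w, t = E1 *m w).
  exact: enveloping_prev.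
have prev2 (t : 'cV_ _) : (exists w, t = projT2 (fres_prev G2 d) *m w) <-> (exists w, t = E2 *m w).
  exact: enveloping_prev.
have Ucong t t' : col_cong E2 t t' -> col_cong E1 (U *m t) (U *m t').
  move=> [w ->]; have [|w2 w2E] := (prev2 (E2 *m w)).2; first by exists w.
  have [|w' w'E] := (prev1 (U *m (E2 *m w))).1; first by rewrite w2E; apply: Ucob.
  by exists w'; rewrite mulmxDr w'E.
have Vcong t t' : col_cong E1 t t' -> col_cong E2 (V *m t) (V *m t').
  move=> [w ->]; have [|w2 w2E] := (prev1 (E1 *m w)).2; first by exists w.
  have [|w' w'E] := (prev2 (V *m (E1 *m w))).1; first by rewrite w2E; apply: Vcob.
  by exists w'; rewrite mulmxDr w'E.
have coc1 : fres_d G1 d *m y1 = 0 by rewrite -map_mxM Dz1 map_mx0.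
have coc2 : fres_d G2 d *m y2 = 0 by rewrite -map_mxM Dz2 map_mx0.
have [u [w uE]] := ker1 _ (Ucoc _ coc2).
have {w uE} uE : col_cong E1 (U *m y2) (y1 *m (sigma u)%:M) by exists w.
have [v [w vE]] := ker2 _ (Vcoc _ coc1).
have {w vE} vE : col_cong E2 (V *m y1) (y2 *m (sigma v)%:M) by exists w.
have UVy : col_cong E1 (U *m (V *m y1)) y1.
  have [w wE] := UV _ coc1; have [w' w'E] := (prev1 _).1 (ex_intro _ w erefl).
  by exists w'; rewrite wE w'E.
have VUy : col_cong E2 (V *m (U *m y2)) y2.
  have [w wE] := VU _ coc2; have [w' w'E] := (prev2 _).1 (ex_intro _ w erefl).
  by exists w'; rewrite wE w'E.
have sigma_inj1 b c : col_cong E1 (y1 *m (sigma b)%:M) (y1 *m (sigma c)%:M) -> b = c.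
  move=> [w wE]; apply/eqP; rewrite -subr_eq0; apply/eqP/(inj1 _ w).
  by rewrite !raddfB /= wE addrC addKr.
have sigma_inj2 b c : col_cong E2 (y2 *m (sigma b)%:M) (y2 *m (sigma c)%:M) -> b = c.
  move=> [w wE]; apply/eqP; rewrite -subr_eq0; apply/eqP/(inj2 _ w).
  by rewrite !raddfB /= wE addrC addKr.
have sigmaM n (t : 'cV[enveloping A]_n) b c :
    t *m (sigma b)%:M *m (sigma c)%:M = t *m (sigma (c * b))%:M.
  by rewrite -mulmxA -scalar_mxM sigma_mul.
have sigma1 n (t : 'cV[enveloping A]_n) : t = t *m (sigma 1)%:M by rewrite mulmx1.
exists u, v; split.
(* The class of [V U y2] is that of [y2], and also that of [y2 sigma(v) sigma(u) = y2 sigma(u v)];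
   comparing coefficients gives [u v = 1]. *)
- apply: sigma_inj2; rewrite -sigma1 -sigmaM.
  apply: col_cong_trans (VUy); apply: col_cong_sym.
  apply: col_cong_trans (Vcong _ _ uE) _; rewrite mulmxA.
  exact: col_cong_mulr.
- apply: sigma_inj1; rewrite -sigma1 -sigmaM.
  apply: col_cong_trans (UVy); apply: col_cong_sym.
  apply: col_cong_trans (Ucong _ _ vE) _; rewrite mulmxA.
  exact: col_cong_mulr.
(* The column [U y2 (x (x) 1)] is evaluated twice: twisting [y2] before [U] is applied, or passing
   to [y1 sigma(u)] and twisting [y1]. *)
move=> x; have tw1 := enveloping_twist H1 char1 x; have tw2 := enveloping_twist H2 char2 x.
apply: sigma_inj1; rewrite -!sigmaM.
apply: (@col_cong_trans _ _ _ _ (U *m y2 *m (tensor x 1)%:M)).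
  apply: col_cong_sym; rewrite -mulmxA.
  by apply: col_cong_trans (Ucong _ _ tw2) _; rewrite mulmxA; apply: col_cong_mulr.
apply: col_cong_trans (col_cong_mulr _ uE) _.
(* [1 (x) u] and [x (x) 1] commute, as they live in different tensor factors. *)
have -> : y1 *m (sigma u)%:M *m (tensor x 1)%:M = y1 *m (tensor x 1)%:M *m (sigma u)%:M.
  by rewrite -!mulmxA -!scalar_mxM !tensorM !mul1r !mulr1.
exact: col_cong_mulr.
Qed.

Theorem theorem0p6 (k : closedFieldType) (A : algType k) (H : hopf_algebra A)
  (P : proj_resolution (left_trivial (counit H)))
  (Q : proj_resolution (right_trivial (counit H)))
  (d : nat) (pi0 : {lrmorphism A -> k^o}) :
  AS_Gorenstein P Q d ->
  bijective (antipode H) ->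
  left_integral_char P d pi0 ->
  exists gamma xi_inv : A -> A,
    [/\ inner_automorphism gamma,
        cancel (left_winding H pi0) xi_inv,
        cancel xi_inv (left_winding H pi0)
      & iter 4 (antipode H) =1 gamma \o right_winding H pi0 \o xi_inv].
Proof.
move=> [[noethA _] _ ext_d _ _ _ _] [S0 SK S0K] char.
have [|S' S'E] := @linear_of_fun k A A S0.
  by move=> c x y; apply: (can_inj SK); rewrite linearP !S0K.
have {}SK : cancel (antipode H) S' by move=> x; rewrite S'E SK.
have {S0K S'E}S'K : cancel S' (antipode H) by move=> x; rewrite S'E S0K.
have [|F _] := @free_resolution_exists A (fun a => (counit H a : k) = 0) noethA.
  exact: counit_ker_submodule.
have [z zP] := integral_column F ext_d char.
(* The co-opposite structure has the same counit, so the same [F] and [z] serve both sides. *)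
have [u [v [uv vu conj]]] :=
  @twists_conjugate k A H (coopposite SK S'K) pi0 d F F z z zP zP.
have [xi_inv xiK xi_invK] := left_winding_bijective H pi0.
pose S := antipode H.
(* The comparison yields [S^2(xi x) = v S^-2(phi x) u]; applying the multiplicative map [S^2] gives
   [S^4(xi x) = S^2(v) phi(x) S^2(u)]. *)
exists (fun a => S (S v) * a * S (S u)), xi_inv; split=> //.
  exists (S (S v)), (S (S u)); split=> //; rewrite -!antipodeM ?vu ?uv !antipode1 //.
move=> a /=; rewrite -{1}[a]xi_invK; set x := xi_inv a.
have := conj x; rewrite left_winding_coopposite /= => conj_x.
have {conj_x}-> : antipode H (antipode H (left_winding H pi0 x)) =
    v * S' (S' (right_winding H pi0 x)) * u.
  by rewrite -mulrA conj_x mulrA vu mul1r.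
by rewrite !antipodeM !S'K.
Qed.
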